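(* Let $n>1$ and let $\varphi:\mathcal A\to M_n(\mathbb C)$ be a map (not assumed linear) that is continuous, multiplicative (i.e. $\varphi(AB)=\varphi(A)\varphi(B)$ for all $A,B\in\mathcal A$), and norm preserving (i.e. $\|\varphi(A)\|=\|A\|$ for all $A\in\mathcal A$). Then there exists a unitary $U\in M_n(\mathbb C)$ such that either $\varphi(A)=UAU^*$ for all $A\in\mathcal A$, or $\varphi(A)=U\overline{A}U^*$ for all $A\in\mathcal A$, where $\overline{A}$ denotes the entrywise complex conjugate of $A$.
   Context: $S$ denotes the $n\times n$ nilpotent Jordan block with ones on the superdiagonal and zeros elsewhere. $\mathcal A=\{f(S): f\text{ a complex polynomial}\}$ is the algebra of $n\times n$ upper-triangular Toeplitz matrices. $\|\cdot\|$ is the operator norm on $M_n(\mathbb C)$ induced by the Euclidean norm on $\mathbb C^n$; continuity is with respect to this norm. *)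

(* Defs.v *)
From Stdlib Require Import Reals ClassicalEpsilon.
From mathcomp Require Import ssreflect ssrfun ssrbool eqtype ssrnat seq fintype bigop.



Unset Printing Implicit Defensive.

Local Open Scope R_scope.

Definition C : Type := (R * R)%type.
Definition C0 : C := (0, 0).
Definition C1 : C := (1, 0).
Definition Cadd (z w : C) : C := (fst z + fst w, snd z + snd w).
Definition Copp (z : C) : C := (- fst z, - snd z).
Definition Cmul (z w : C) : C :=
  (fst z * fst w - snd z * snd w, fst z * snd w + snd z * fst w).
Definition Cconj (z : C) : C := (fst z, - snd z).
Definition Cnorm2 (z : C) : R := fst z * fst z + snd z * snd z.

Definition Mat (n : nat) : Type := 'I_n -> 'I_n -> C.
Definition Vec (n : nat) : Type := 'I_n -> C.

Definition mzero (n : nat) : Mat n := fun _ _ => C0.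
Definition mid (n : nat) : Mat n := fun i j => if i == j then C1 else C0.
Definition madd {n : nat} (A B : Mat n) : Mat n := fun i j => Cadd (A i j) (B i j).
Definition msub {n : nat} (A B : Mat n) : Mat n := fun i j => Cadd (A i j) (Copp (B i j)).
Definition mscale {n : nat} (c : C) (A : Mat n) : Mat n := fun i j => Cmul c (A i j).
Definition mmul {n : nat} (A B : Mat n) : Mat n :=
  fun i j => \big[Cadd/C0]_(k < n) Cmul (A i k) (B k j).
Definition mconj {n : nat} (A : Mat n) : Mat n := fun i j => Cconj (A i j).
Definition madj {n : nat} (A : Mat n) : Mat n := fun i j => Cconj (A j i).

Definition unitary {n : nat} (U : Mat n) : Prop :=
  mmul U (madj U) = mid n /\ mmul (madj U) U = mid n.

Definition mvmul {n : nat} (A : Mat n) (v : Vec n) : Vec n :=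
  fun i => \big[Cadd/C0]_(k < n) Cmul (A i k) (v k).
Definition vnorm {n : nat} (v : Vec n) : R :=
  sqrt (\big[Rplus/0]_(i < n) Cnorm2 (v i)).

Definition Rsup (E : R -> Prop) : R := epsilon (inhabits 0) (fun r => is_lub E r).

Definition opnorm {n : nat} (A : Mat n) : R :=
  Rsup (fun r => exists v : Vec n, vnorm v <= 1 /\ r = vnorm (mvmul A v)).

Definition Sjordan (n : nat) : Mat n :=
  fun i j => if (nat_of_ord j == (nat_of_ord i).+1)%N then C1 else C0.

(* f(S) for the polynomial f with coefficient list cs = [c0; c1; ...]
   (Horner scheme: f(S) = c0 I + S (c1 I + S (...))) *)
Fixpoint poly_at_S (n : nat) (cs : list C) : Mat n :=
  match cs with
  | nil => mzero n
  | c :: cs' => madd (mscale c (mid n)) (mmul (Sjordan n) (poly_at_S n cs'))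
  end.

Definition inA {n : nat} (M : Mat n) : Prop := exists cs : list C, M = poly_at_S n cs.

(* Main.v *)
(** Put T = phi(S).  T is a nilpotent contraction and T^(n-1) has norm one, so a
    unit vector v at which this norm is attained has an orthonormal orbit
    v, T v, ..., T^(n-1) v; in this basis T is the shift.  After a unitary
    conjugation phi fixes S, hence maps the algebra into the commutant of S,
    which is the algebra itself.

    On scalars phi is a character chi, since the last column of phi(c) leaves no
    room for off-diagonal entries.  Modulo S^2 one has
    phi(1 + w S) = psi(w) (1 + beta(w) S) with psi an additive character and beta
    an additive isometry of the plane, so beta(w) = u w or u w^*; composing with
    the conjugation we may assume the former.  Continuity at S along S + l then
    forces chi = id, psi = 1 and u = 1.

    For 0 < |a| <= 1 the contraction (S - a)(1 - a^* S)^-1 is determined by its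
    two lowest coefficients, hence fixed by phi.  So
    G(w) = phi(1 + w S) (1 + w S)^-1 satisfies G(-1/a) = G(-a^* ) and is therefore
    bounded.  By the fundamental theorem of algebra every power of 1 + w S is a
    product of at most n - 1 factors 1 + w_i S, so the powers of the unipotent
    matrix G(w) are bounded as well and G(w) = 1.  Finally phi is the identity
    because every polynomial splits into linear factors. *)

From Stdlib Require Import Reals ClassicalEpsilon.
From mathcomp Require Import all_boot all_order all_algebra ring zify complex.
From mathcomp Require Import all_classical all_reals all_analysis Rstruct.
Require Import Defs.
Set Implicit Arguments.
Unset Strict Implicit.
Unset Printing Implicit Defensive.
Import Order.TTheory GRing.Theory Num.Theory numFieldNormedType.Exports.
Local Open Scope ring_scope.

(** * Squared norms *)

Section Norm.
Variable (C : numClosedFieldType).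

Definition inner n (u w : 'cV[C]_n) : C := \sum_i u i 0 * (w i 0)^*.
Definition sqnorm n (v : 'cV[C]_n) : C := \sum_i `|v i 0| ^+ 2.
(* [s] bounds the square of the operator norm. *)
Definition bounded_by n (s : C) (A : 'M[C]_n) := forall v, sqnorm (A *m v) <= s * sqnorm v.
Definition adj n (A : 'M[C]_n) : 'M[C]_n := (map_mx Num.conj A)^T.

Lemma sqnorm_inner n (v : 'cV[C]_n) : sqnorm v = inner v v.
Proof. by apply: eq_bigr => i _; rewrite normCK. Qed.

Lemma sqnorm_ge0 n (v : 'cV[C]_n) : 0 <= sqnorm v.
Proof. by apply: sumr_ge0 => i _; rewrite exprn_ge0. Qed.

Lemma sqnorm_eq0 n (v : 'cV[C]_n) : sqnorm v = 0 -> v = 0.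
Proof.
move=> v0; apply/colP => i; rewrite mxE.
have : `|v i 0| ^+ 2 == 0.
  by move/eqP: v0; rewrite psumr_eq0 => [/allP/(_ i (mem_index_enum i))//|j _]; rewrite exprn_ge0.
by rewrite expf_eq0 /= normr_eq0 => /eqP.
Qed.

Lemma sqnorm0 n : sqnorm (0 : 'cV[C]_n) = 0.
Proof. by rewrite /sqnorm big1// => i _; rewrite mxE normr0 expr0n. Qed.

Lemma innerC n (u w : 'cV[C]_n) : inner u w = (inner w u)^*.
Proof.
rewrite /inner rmorph_sum; apply: eq_bigr => i _.
by rewrite rmorphM /= conjCK mulrC.
Qed.

Lemma sqnorm_addZ n c (x y : 'cV[C]_n) :
  sqnorm (x + c *: y) = sqnorm x + c * inner y x + (c * inner y x)^* + `|c| ^+ 2 * sqnorm y.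
Proof.
rewrite /sqnorm /inner mulr_sumr rmorph_sum mulr_sumr -!big_split.
apply: eq_bigr => i _; rewrite !mxE !normCK !rmorphD !rmorphM /= conjCK; ring.
Qed.

Lemma sqnormZ n c (v : 'cV[C]_n) : sqnorm (c *: v) = `|c| ^+ 2 * sqnorm v.
Proof. by rewrite /sqnorm mulr_sumr; apply: eq_bigr => i _; rewrite mxE normrM exprMn. Qed.

(** The parallelogram law, with the nonnegative term [sqnorm (u - v)] dropped. *)
Lemma sqnormD_le n (u v : 'cV[C]_n) : sqnorm (u + v) <= 2 * sqnorm u + 2 * sqnorm v.
Proof.
have -> : 2 * sqnorm u + 2 * sqnorm v = sqnorm (u + v) + sqnorm (u - v).
  have := sqnorm_addZ 1 u v; have := sqnorm_addZ (- 1) u v.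
  by rewrite scale1r scaleN1r => -> ->; rewrite normrN normr1 !rmorphM rmorphN rmorph1; ring.
by rewrite lerDl sqnorm_ge0.
Qed.

(* At a vector where a contraction attains norm one it acts like an isometry:
   perturb [x] by a small multiple of [y]. *)
Lemma contraction_inner n (T : 'M[C]_n) x y :
  bounded_by 1 T -> sqnorm (T *m x) = sqnorm x -> inner (T *m y) (T *m x) = inner y x.
Proof.
move=> bT ex; apply/eqP; rewrite -subr_eq0; apply/eqP.
set d := _ - _; set K := sqnorm y - sqnorm (T *m y).
have K0 : 0 <= K by rewrite subr_ge0; have := bT y; rewrite mul1r.
(* Perturbing by [t * d^*] times [y] changes the norm deficit, which is zero at [x], to
   [t * |d|^2 * (t * K - 2)]. This [t] gives [t * K <= 1], so the deficit can only be nonnegative if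
   [d = 0]. *)
pose t := (K + 1)^-1.
have t0 : 0 < t by rewrite invr_gt0 ltr_wpDl.
have tK : t * K <= 1 by rewrite mulrC ler_pdivrMr ?mul1r ?lerDl ?ler01 // ltr_wpDl.
have := bT (x + (t * d^*) *: y).
rewrite mulmxDr -scalemxAr mul1r !sqnorm_addZ ex -subr_ge0.
have -> : sqnorm x + t * d^* * inner y x + (t * d^* * inner y x)^* +
  `|t * d^*| ^+ 2 * sqnorm y -
  (sqnorm x + t * d^* * inner (T *m y) (T *m x) + (t * d^* * inner (T *m y) (T *m x))^* +
   `|t * d^*| ^+ 2 * sqnorm (T *m y)) = t * `|d| ^+ 2 * (t * K - 2).
  have tr : t^* = t by apply: CrealP; rewrite ger0_real ?ltW.
  rewrite !normCK !rmorphM /= !conjCK tr /d /K rmorphB /=; ring.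
have t2 : t * K - 2 < 0.
  by rewrite subr_lt0 (le_lt_trans tK)// ltr1n.
rewrite nmulr_lge0 // pmulr_rle0 // => d0.
have : `|d| ^+ 2 == 0 by rewrite eq_le d0 exprn_ge0.
by rewrite expf_eq0 /= normr_eq0 => /eqP.
Qed.

Lemma sqnorm_adj n (U : 'M[C]_n) v : adj U *m U = 1%:M -> sqnorm (U *m v) = sqnorm v.
Proof.
have E (w : 'cV[C]_n) : sqnorm w = ((map_mx Num.conj w)^T *m w) 0 0.
  by rewrite mxE; apply: eq_bigr => i _; rewrite !mxE normCKC.
move=> UU; rewrite !E map_mxM trmx_mul -mulmxA (mulmxA _ U) -/(adj U) UU.
by rewrite mul1mx.
Qed.

Lemma adjK n (U : 'M[C]_n) : adj (adj U) = U.
Proof. by apply/matrixP => i j; rewrite !mxE conjCK. Qed.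

Lemma bounded_by_adj n (U A : 'M[C]_n) s : adj U *m U = 1%:M ->
  bounded_by s (adj U *m A *m U) <-> bounded_by s A.
Proof.
move=> UU; have UU' := mulmx1C UU.
have e v : sqnorm (adj U *m v) = sqnorm v by apply: sqnorm_adj; rewrite adjK.
split=> b v; last by rewrite -!mulmxA e -[sqnorm v](sqnorm_adj _ UU) b.
have := b (adj U *m v); rewrite -!mulmxA e (mulmxA U) UU' mul1mx.
by rewrite e.
Qed.

Lemma sqnorm_delta n (j : 'I_n) : sqnorm (delta_mx j 0 : 'cV[C]_n) = 1.
Proof.
rewrite /sqnorm (bigD1 j)//= big1 ?addr0 ?mxE ?eqxx ?normr1 ?expr1n//.
by move=> i /negPf ij; rewrite !mxE ij normr0 expr0n.
Qed.

Lemma bounded_by_col n s (A : 'M[C]_n) j : bounded_by s A -> \sum_i `|A i j| ^+ 2 <= s.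
Proof.
move=> /(_ (delta_mx j 0)); rewrite sqnorm_delta mulr1 -colE.
by congr (_ <= _); apply: eq_bigr => i _; rewrite mxE.
Qed.

Lemma bounded_by_entry n s (A : 'M[C]_n) i j : bounded_by s A -> `|A i j| ^+ 2 <= s.
Proof.
move=> /(bounded_by_col j); apply: le_trans; rewrite (bigD1 i)//= lerDl.
by apply: sumr_ge0 => k _; rewrite exprn_ge0.
Qed.

Lemma bounded_by0 n (A : 'M[C]_n) : bounded_by 0 A -> A = 0.
Proof.
move=> b; apply/matrixP => i j; rewrite mxE; have := bounded_by_entry i j b.
rewrite -[0]/(0 : C) => le0; have : `|A i j| ^+ 2 == 0 by rewrite eq_le le0 exprn_ge0.
by rewrite expf_eq0 /= normr_eq0 => /eqP.
Qed.

Lemma bounded_by_scalar n (c : C) : bounded_by (`|c| ^+ 2) (c%:M : 'M[C]_n).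
Proof. by move=> v; rewrite mul_scalar_mx sqnormZ. Qed.

Lemma sqnorm_conj n (v : 'cV[C]_n) : sqnorm (map_mx Num.conj v) = sqnorm v.
Proof. by apply: eq_bigr => i _; rewrite mxE norm_conjC. Qed.

Lemma bounded_by_conj n s (A : 'M[C]_n) : bounded_by s A -> bounded_by s (map_mx Num.conj A).
Proof.
move=> b v; have := b (map_mx Num.conj v); rewrite sqnorm_conj.
have -> : map_mx Num.conj A *m v = map_mx Num.conj (A *m map_mx Num.conj v).
  rewrite map_mxM; congr (_ *m _).
  by apply/matrixP => i j; rewrite !mxE /= conjCK.
by rewrite sqnorm_conj.
Qed.

End Norm.

(** * Polynomials in the shift *)

Section Shift.
Variables (C : numClosedFieldType) (m : nat).

Definition shift : 'M[C]_m.+1 := \matrix_(i, j) ((j == i.+1 :> nat)%:R).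
Definition shift_poly (p : {poly C}) : 'M[C]_m.+1 := horner_mx shift p.
Local Notation hS := shift_poly.

Lemma mulmx_shift (A : 'M[C]_m.+1) i j :
  (A *m shift) i j = if j == 0 then 0 else A i (inord j.-1).
Proof.
rewrite mxE; case: eqVneq => [->|j0].
  by rewrite big1// => k _; rewrite mxE mulr0.
have jk : j = (j.-1).+1 :> nat by rewrite prednK // lt0n.
have jm : (j.-1 < m.+1)%N by rewrite (leq_ltn_trans (leq_pred _)).
rewrite (bigD1 (inord j.-1))//= big1 ?addr0 => [|k kj].
  by rewrite mxE inordK// -jk eqxx mulr1.
rewrite mxE jk eqSS; case: eqP => [e|]; last by rewrite mulr0.
by case/eqP: kj; apply: val_inj; rewrite /= inordK.
Qed.

Lemma shift_mulmx p (A : 'M[C]_(m.+1, p)) i j :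
  (shift *m A) i j = if (i < m)%N then A (inord i.+1) j else 0.
Proof.
rewrite mxE; case: ltnP => im.
  rewrite (bigD1 (inord i.+1))//= big1 ?addr0 => [|k ki].
    by rewrite mxE inordK ?eqxx ?mul1r.
  rewrite mxE; case: eqP => [e|]; last by rewrite mul0r.
  by case/eqP: ki; apply: val_inj; rewrite /= inordK.
rewrite big1// => k _; rewrite mxE; case: eqP => [e|]; last by rewrite mul0r.
by have := ltn_ord k; rewrite e ltnS leqNgt ltnS im.
Qed.

Lemma shift_polyM p q : hS (p * q) = hS p *m hS q. Proof. exact: rmorphM. Qed.
Lemma shift_polyD p q : hS (p + q) = hS p + hS q. Proof. exact: rmorphD. Qed.
Lemma shift_polyB p q : hS (p - q) = hS p - hS q. Proof. exact: rmorphB. Qed.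
Lemma shift_polyX : hS 'X = shift. Proof. exact: horner_mx_X. Qed.
Lemma shift_polyC c : hS c%:P = c%:M. Proof. exact: horner_mx_C. Qed.
Lemma shift_poly0 : hS 0 = 0. Proof. exact: rmorph0. Qed.
Lemma shift_poly1 : hS 1 = 1%:M. Proof. exact: rmorph1. Qed.

Lemma shift_poly_comm p q : hS p *m hS q = hS q *m hS p.
Proof. by rewrite -!shift_polyM mulrC. Qed.

(** Induction on the Horner form: right multiplication by the shift moves each column one place to
    the right. *)
Lemma shift_polyE p (i j : 'I_m.+1) : hS p i j = if (i <= j)%N then p`_(j - i) else 0.
Proof.
elim/poly_ind: p i j => [|p c IH] i j.
  by rewrite /shift_poly rmorph0 mxE coef0 if_same.
rewrite shift_polyD shift_polyM shift_polyX shift_polyC mxE mulmx_shift coefD coefMX coefC.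
case: eqVneq => [->|j0].
  rewrite add0r mxE sub0n leqn0 eqxx add0r.
  by case: (eqVneq i 0) => [->|i0]; rewrite ?eqxx // (negPf (i0 : val i != _)).
have jk : j = (j.-1).+1 :> nat by rewrite prednK // lt0n.
have jm : (j.-1 < m.+1)%N by rewrite (leq_ltn_trans (leq_pred _)).
rewrite IH inordK// mxE; case: (ltngtP i j) => ij.
- have -> : (i == j) = false by rewrite -val_eqE /=; apply/eqP => e; rewrite e ltnn in ij.
  rewrite -ltnS -jk ij mulr0n subn_eq0 leqNgt ij /= !addr0.
  by congr (_`_ _); rewrite jk subSn //= -ltnS -jk.
- have -> : (i == j) = false by rewrite -val_eqE /=; apply/eqP => e; rewrite e ltnn in ij.
  by rewrite leqNgt (leq_ltn_trans (leq_pred _) ij) /= addr0.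
- by rewrite (val_inj ij) eqxx subnn eqxx leqNgt {2}jk ltnSn /=.
Qed.

Lemma shift_poly_eq (p q : {poly C}) : (forall k, (k < m.+1)%N -> p`_k = q`_k) -> hS p = hS q.
Proof.
move=> e; apply/matrixP => i j; rewrite !shift_polyE; case: ifP => // _.
by rewrite e // (leq_ltn_trans (leq_subr _ _)).
Qed.

Lemma coef_shift_poly (p q : {poly C}) k : (k < m.+1)%N -> hS p = hS q -> p`_k = q`_k.
Proof.
move=> km /matrixP/(_ 0 (inord k)); rewrite !shift_polyE /= inordK // subn0.
by [].
Qed.

(** The first row read as a polynomial; for a matrix in the algebra this recovers its symbol modulo
    X^(m+1). *)
Definition topoly (A : 'M[C]_m.+1) : {poly C} := \poly_(k < m.+1) A 0 (inord k).

(** Commutation equates entry (i+1, j) with entry (i, j-1), and with 0 when j = 0, so the first row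
    propagates down the diagonals. *)
Lemma comm_shift A : A *m shift = shift *m A -> A = hS (topoly A).
Proof.
move=> cA; apply/matrixP => i j.
rewrite shift_polyE coef_poly (leq_ltn_trans (leq_subr _ _) (ltn_ord j)).
case: i => i im; elim: i im j => [|i IH] im j.
  by rewrite leq0n subn0 inord_val; congr (A _ _); apply: val_inj.
have im' := ltnW im.
have := congr1 (fun B : 'M[C]_m.+1 => B (Ordinal im') j) cA.
rewrite mulmx_shift shift_mulmx /= -ltnS im.
have -> : inord i.+1 = Ordinal im by apply: val_inj; rewrite /= inordK.
move=> <-; case: eqVneq => [->//|j0].
have jk : j = (j.-1).+1 :> nat by rewrite prednK // lt0n.
have jm : (j.-1 < m.+1)%N by rewrite (leq_ltn_trans (leq_pred _)).
by rewrite IH /= inordK// [in RHS]jk ltnS subSS.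
Qed.

(** The last column of [hS p] lists the coefficients in reverse order, and it is the image of a unit
    vector. *)
Lemma bounded_by_coefs s (p : {poly C}) : bounded_by s (hS p) -> \sum_(k < m.+1) `|p`_k| ^+ 2
  <= s.
Proof.
move=> /(bounded_by_col ord_max); congr (_ <= _).
rewrite (reindex_inj rev_ord_inj); apply: eq_bigr => i _.
by rewrite shift_polyE /= subSS leq_subr subKn // -ltnS.
Qed.

Lemma bounded_by_coef s (p : {poly C}) k : (k < m.+1)%N -> bounded_by s (hS p) -> `|p`_k| ^+ 2
  <= s.
Proof.
move=> km /bounded_by_coefs; apply: le_trans; rewrite (bigD1 (Ordinal km))//= lerDl.
by apply: sumr_ge0 => i _; rewrite exprn_ge0.
Qed.

(** The shift discards the first coordinate and moves the others up. *)
Lemma sqnorm_shift (x : 'cV[C]_m.+1) :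
  sqnorm (shift *m x) = sqnorm x - `|x 0 0| ^+ 2.
Proof.
rewrite /sqnorm [X in _ = X - _]big_ord_recl [X in _ = X - _]addrC addrK.
rewrite big_ord_recr /= shift_mulmx ltnn normr0 expr0n addr0.
apply: eq_bigr => i _; rewrite shift_mulmx /= ltn_ord.
by congr (`|x _ _| ^+ 2); apply: val_inj; rewrite /= inordK ?ltnS.
Qed.

Lemma bounded_by_shift : bounded_by 1 shift.
Proof. by move=> v; rewrite mul1r sqnorm_shift gerBl exprn_ge0. Qed.

Lemma conj_shift : map_mx Num.conj shift = shift.
Proof. by apply/matrixP => i j; rewrite !mxE; case: eqP => _; rewrite ?rmorph1 ?rmorph0. Qed.

End Shift.

(** * Norms of corner blocks *)

Section BlockNorms.
Variable C : numClosedFieldType.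

Lemma bounded_by_mul n s t (A B : 'M[C]_n) :
  0 <= s -> bounded_by s A -> bounded_by t B -> bounded_by (s * t) (A *m B).
Proof.
move=> s0 bA bB v; rewrite -mulmxA (le_trans (bA _))// -mulrA.
by rewrite ler_wpM2l.
Qed.

Lemma bounded_by_Xn m k : bounded_by 1 (shift_poly m 'X^k : 'M[C]_m.+1).
Proof.
elim: k => [|k IH]; first by rewrite expr0 shift_poly1 => v; rewrite mul1mx mul1r.
by rewrite exprS shift_polyM shift_polyX -[1]mul1r; apply: bounded_by_mul => //; apply:
  bounded_by_shift.
Qed.

(** Modulo X^(m+1) only the constant term of [p] survives, as a single entry in the top right
    corner. *)
Lemma bounded_by_Xn_corner m s (p : {poly C}) :
  bounded_by s (shift_poly m ('X^m * p)) <-> `|p`_0| ^+ 2 <= s.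
Proof.
split=> [b|le].
  by have := bounded_by_coef (ltnSn m) b; rewrite coefXnM ltnn subnn.
have -> : shift_poly m ('X^m * p) = shift_poly m ((p`_0)%:P * 'X^m).
  apply: shift_poly_eq => k; rewrite ltnS => km; rewrite coefXnM coefCM coefXn.
  by case: ltngtP km => // [_|->] _; rewrite ?mulr0 // subnn mulr1.
rewrite shift_polyM shift_polyC => v.
rewrite (le_trans (bounded_by_mul _ (@bounded_by_scalar _ _ _) (@bounded_by_Xn m m) v))
  ?exprn_ge0//.
by rewrite mulr1 ler_wpM2r ?sqnorm_ge0.
Qed.

(** In size m + 2 the only nonzero part of the matrix is the block [[p_0, p_1], [0, p_0]] in the top
    right corner. *)
Lemma shift_poly_corner2 m (p : {poly C}) (v : 'cV[C]_m.+2) :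
  sqnorm (shift_poly m.+1 ('X^m * p) *m v) =
  `|p`_0 * v (inord m) 0 + p`_1 * v (inord m.+1) 0| ^+ 2
  + `|p`_0 * v (inord m.+1) 0| ^+ 2.
Proof.
have o2 : ord_max = inord m.+1 :> 'I_m.+2 by apply: val_inj; rewrite /= inordK.
have o1 : widen_ord (leqnSn m.+1) ord_max = inord m :> 'I_m.+2.
  by apply: val_inj; rewrite /= inordK.
rewrite /sqnorm 2!big_ord_recl /= addrA big1 ?addr0 => [|i _]; last first.
  rewrite mxE big1 ?normr0 ?expr0n// => j _.
  rewrite shift_polyE coefXnM; case: ifP => _; last by rewrite mul0r.
  rewrite ifT ?mul0r//.
  rewrite /= /bump. have := ltn_ord j; have := ltn_ord i; lia.
have -> : (shift_poly m.+1 ('X^m * p) *m v) ord0 0 =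
    p`_0 * v (inord m) 0 + p`_1 * v (inord m.+1) 0.
  rewrite mxE 2!big_ord_recr /= big1 ?add0r => [|j _].
    rewrite !shift_polyE /= !subn0 !coefXnM ltnn ltnNge leqnSn /= subnn subSn // subnn.
    by rewrite o1 o2.
  by rewrite shift_polyE /= subn0 coefXnM ltn_ord mul0r.
have -> // : (shift_poly m.+1 ('X^m * p) *m v) (lift ord0 ord0) 0 = p`_0 * v (inord m.+1) 0.
rewrite mxE big_ord_recr /= big1 ?add0r => [|j _].
  by rewrite shift_polyE /= /bump /= !add1n subSS subn0 coefXnM ltnn subnn o2.
rewrite shift_polyE coefXnM /= /bump /= addn0; have := ltn_ord j.
case: ifP => j1 jm; last by rewrite mul0r.
by rewrite ifT ?mul0r//; move: j1 jm; lia.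
Qed.

(* [t ^+ 2] is the squared norm of the block [[a, c], [0, a]], [|a| = 1]. *)
Lemma block_norm (b : C) : 0 <= b -> exists2 t : C, 0 < t & t ^+ 2 = 1 + b * t.
Proof.
move=> b0; exists ((b + sqrtC (b ^+ 2 + 4)) / 2).
  by rewrite divr_gt0 ?ltr0n// ltr_wpDl// sqrtC_gt0 ltr_wpDl ?exprn_ge0 ?ltr0n.
by rewrite expr_div_n sqrrD sqrtCK; field.
Qed.

(** The norm of a block [[a, c], [0, a]] with |a| = 1 grows with |c|. The bound [t ^+ 2] for the
    block of [p] passes to that of [q]; testing it on one vector compares the off-diagonal
    moduli. *)
Lemma block_norm_le m (p q : {poly C}) : `|p`_0| = 1 -> `|q`_0| = 1 ->
  (forall s, bounded_by s (shift_poly m.+1 ('X^m * p)) -> bounded_by s (shift_poly m.+1 ('X^m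
    * q))) ->
  `|q`_1| <= `|p`_1|.
Proof.
move=> p1 q1 pq; set b := `|p`_1|; set b' := `|q`_1|.
have b0 : 0 <= b by apply: normr_ge0.
have [t t0 te] := block_norm b0.
have : bounded_by (t ^+ 2) (shift_poly m.+1 ('X^m * p)).
  move=> v; rewrite shift_poly_corner2.
  set x := v _ _; set y := v _ _.
  have le2 : `|x| ^+ 2 + `|y| ^+ 2 <= sqnorm v.
    have mm : inord m.+1 != inord m :> 'I_m.+2.
      by rewrite -val_eqE /= !inordK; lia.
    rewrite /sqnorm (bigD1 (inord m))//= (bigD1 (inord m.+1))//= addrA lerDl.
    by apply: sumr_ge0 => i _; rewrite exprn_ge0.
  apply: le_trans (_ : t ^+ 2 * (`|x| ^+ 2 + `|y| ^+ 2) <= _); last first.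
    by rewrite ler_wpM2l// exprn_ge0// ltW.
  apply: le_trans (_ : (`|x| + b * `|y|) ^+ 2 + `|y| ^+ 2 <= _).
    rewrite normrM p1 mul1r lerD2r lerXn2r ?nnegrE ?addr_ge0 ?mulr_ge0//.
    by rewrite (le_trans (ler_normD _ _))// !normrM p1 mul1r.
  (* After multiplication by [t], the relation [t ^+ 2 = 1 + b * t] turns the difference into [b]
     times a square. *)
  rewrite -subr_ge0 -(pmulr_rge0 _ t0).
  have -> : t * (t ^+ 2 * (`|x| ^+ 2 + `|y| ^+ 2) -
      ((`|x| + b * `|y|) ^+ 2 + `|y| ^+ 2)) = b * (t * `|x| - `|y|) ^+ 2.
    by rewrite te; transitivity (b * (t ^+ 2 * `|x| ^+ 2 + (t ^+ 2 - b * t) * `|y| ^+ 2 - 2 *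
      t * `|x| * `|y|)); [ring|rewrite te; ring: te].
  by rewrite mulr_ge0// real_exprn_even_ge0// realB// realM// gtr0_real.
move=> /pq bq; have [->//|n0] := eqVneq b' 0.
have b'0 : 0 < b' by rewrite lt0r n0 normr_ge0.
(* The moduli 1 and [t] make the square above vanish; the phase of the first coordinate makes the
   two terms of the top row add up without cancellation. *)
pose v : 'cV[C]_m.+2 := \col_i (if i == inord m then q`_1 / b' * (q`_0)^*
  else if i == inord m.+1 then t else 0).
have mm : inord m.+1 != inord m :> 'I_m.+2.
  by rewrite -val_eqE /= !inordK; lia.
have qq : q`_0 * (q`_0)^* = 1 by rewrite -normCK q1 expr1n.
have := bq v; rewrite shift_poly_corner2 !mxE !eqxx (negPf mm).
have -> : sqnorm v = 1 + t ^+ 2.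
  rewrite /sqnorm (bigD1 (inord m))//= (bigD1 (inord m.+1))//= big1 ?addr0.
    rewrite !mxE !eqxx (negPf mm) !normrM norm_conjC q1 mulr1 normfV.
    by rewrite (ger0_norm (ltW b'0)) divff// expr1n (gtr0_norm t0).
  by move=> i /andP[/negPf i1 /negPf i2]; rewrite mxE i1 i2 normr0 expr0n.
have -> : q`_0 * (q`_1 / b' * (q`_0)^*) + q`_1 * t = q`_1 / b' * (1 + b' * t).
  rewrite mulrDr mulr1 mulrCA qq mulr1; congr (_ + _).
  by rewrite mulrA divfK.
rewrite !normrM q1 mul1r normfV (ger0_norm (ltW b'0)) divff// mul1r.
rewrite (gtr0_norm t0) ger0_norm; last by rewrite addr_ge0 ?mulr_ge0 // ltW.
rewrite mulrDr mulr1 -expr2 addrC lerD2l ler_sqr ?nnegrE; last 2 first.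
- by rewrite addr_ge0 ?mulr_ge0 // ltW.
- by rewrite exprn_ge0// ltW.
by rewrite te lerD2l ler_pM2r.
Qed.

End BlockNorms.

(** * Characters and isometries of the plane *)

Section Scalars.
Variable C : numClosedFieldType.

(** The distances to 0 and 1 fix the modulus and the real part of [g w], which leaves only [w] and
    its conjugate. *)
Lemma isometry_fix1 (g : C -> C) : (forall x y, g (x + y) = g x + g y) ->
  (forall x, `|g x| = `|x|) -> g 1 = 1 -> forall w, g w = w \/ g w = w^*.
Proof.
move=> gD gN g1 w.
have gB1 : g w = g (w - 1) + 1 by rewrite -{2}g1 -gD subrK.
have e0 : g w * (g w)^* = w * w^* by rewrite -!normCK gN.
have e1 : (g w - 1) * (g w - 1)^* = (w - 1) * (w - 1)^*.
  by rewrite -!normCK {1}gB1 addrK gN.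
have e2 : g w + (g w)^* = w + w^*.
  move: e1; rewrite !rmorphB !rmorph1 => e1.
  have -> : g w + (g w)^* = g w * (g w)^* + 1 - (g w - 1) * ((g w)^* - 1) by ring.
  by rewrite e1 e0; ring.
have : (g w - w) * (g w - w^*) = 0.
  have -> : (g w - w) * (g w - w^*) = g w * g w - g w * (w + w^*) + w * w^* by ring.
  by rewrite -e2 -e0; ring.
by move/eqP; rewrite mulf_eq0 !subr_eq0 => /orP[]/eqP; [left|right].
Qed.

(** If [g w] were the conjugate of [w], equal distances to ['i] would force [w] to be real. *)
Lemma isometry_fixi (g : C -> C) : (forall x y, g (x + y) = g x + g y) ->
  (forall x, `|g x| = `|x|) -> g 1 = 1 -> g 'i = 'i -> forall w, g w = w.
Proof.
move=> gD gN g1 gi w; have [//|e] := isometry_fix1 gD gN g1 w.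
have gBi : g w = g (w - 'i) + 'i by rewrite -{2}gi -gD subrK.
have e1 : (g w - 'i) * (g w - 'i)^* = (w - 'i) * (w - 'i)^*.
  by rewrite -!normCK {1}gBi addrK gN.
rewrite e; apply/eqP; rewrite -subr_eq0.
have : 2 * 'i * (w^* - w) = 0.
  move: e1; rewrite e !rmorphB /= conjCK conjCi !opprK => e1.
  have -> : 2 * 'i * (w^* - w) = (w^* - 'i) * (w + 'i) - (w - 'i) * (w^* + 'i) by ring.
  by rewrite e1 subrr.
move/eqP; rewrite mulf_eq0 mulf_eq0 pnatr_eq0 /= => /orP[]//.
by rewrite (negPf (neq0Ci C)).
Qed.

(** Division by the unit [g 1] gives an isometry fixing 1; whether it fixes or conjugates ['i]
    decides the form for all [w] at once. *)
Lemma isometry_plane (g : C -> C) : (forall x y, g (x + y) = g x + g y) ->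
  (forall x, `|g x| = `|x|) -> exists2 u, `|u| = 1 &
  (forall w, g w = u * w) \/ (forall w, g w = u * w^*).
Proof.
move=> gD gN; exists (g 1); first by rewrite gN normr1.
have uu : g 1 * (g 1)^* = 1 by rewrite -normCK gN normr1 expr1n.
pose h w := (g 1)^* * g w.
have gh w : g w = g 1 * h w by rewrite /h mulrA uu mul1r.
have hD x y : h (x + y) = h x + h y by rewrite /h gD mulrDr.
have hN x : `|h x| = `|x| by rewrite /h normrM norm_conjC !gN normr1 mul1r.
have h1 : h 1 = 1 by rewrite /h mulrC.
have [hi|hi] := isometry_fix1 hD hN h1 'i.
  by left=> w; rewrite gh (isometry_fixi hD hN h1).
right=> w; rewrite gh -[h w]conjCK; congr (_ * (_)^*).
apply: (@isometry_fixi (fun w => (h w)^*)) => [x y|x||].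
- by rewrite hD rmorphD.
- by rewrite norm_conjC.
- by rewrite h1 rmorph1.
- by rewrite hi conjCK.
Qed.

Lemma eps_eq0 (x : C) : (forall e : C, 0 < e -> `|x| <= e) -> x = 0.
Proof.
move=> h; apply/eqP; apply: contraT => x0.
have xp : 0 < `|x| by rewrite normr_gt0.
have := h (`|x| / 2) (divr_gt0 xp (ltr0n _ 2)).
by rewrite ler_pdivlMr ?ltr0n// mulr_natr mulr2n gerDl lt_geF.
Qed.

(** In the application [chi c] is the image of the scalar [c], while [psi w] and [psi w * (u * w)]
    are the two lowest coefficients of the image of 1 + w S. As S + l = l (1 + S / l), [lim] says
    that the linear coefficient of the image of S + l tends to 1. *)
Variables (chi psi : C -> C) (u : C).
Hypothesis chiM : forall x y, chi (x * y) = chi x * chi y.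
Hypothesis chiN : forall x, `|chi x| = `|x|.
Hypothesis psiD : forall x y, psi (x + y) = psi x * psi y.
Hypothesis psiN : forall x, `|psi x| = 1.
Hypothesis uN : `|u| = 1.
Hypothesis lim : forall e : C, 0 < e -> exists2 d : C, 0 < d & forall l, l != 0 -> `|l| < d ->
  `|chi l * psi l^-1 * u / l - 1| <= e.

(* Comparing the limit along [l] and [l / 2]. *)
Lemma char_limit e : 0 < e -> exists2 d, 0 < d & forall l, l != 0 -> `|l| < d ->
  `|psi l^-1 - (chi 2^-1 * 2)^-1| <= e.
Proof.
move=> e0; have [d d0 H] := lim (divr_gt0 e0 (ltr0n _ 2)).
exists d => // l l0 ld.
have n2 : (2 : C) != 0 by rewrite pnatr_eq0.
set k := chi 2^-1 * 2.
have kN : `|k| = 1 by rewrite normrM chiN -normrM mulVf// normr1.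
have k0 : k != 0 by rewrite -normr_eq0 kN oner_eq0.
set g := chi l * psi l^-1 * u / l.
have g1 : `|g - 1| <= e / 2 by exact: H.
have : `|g * (psi l^-1 * k) - 1| <= e / 2.
  (* The inverse of [l / 2] is [l^-1 + l^-1], so halving [l] multiplies the quotient [g] by
     [psi l^-1 * k]. *)
  have -> : g * (psi l^-1 * k) = chi (2^-1 * l) * psi (2^-1 * l)^-1 * u / (2^-1 * l).
    have -> : (2^-1 * l)^-1 = l^-1 + l^-1 by rewrite invfM invrK; field.
    by rewrite psiD chiM /g /k; field; rewrite l0.
  apply: H; rewrite ?mulf_neq0 ?invr_eq0//.
  rewrite normrM normfV (ger0_norm (ler0n _ 2)) (le_lt_trans _ ld)//.
  by rewrite ler_piMl// invf_le1 ?ltr0n// ler1n.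
move=> g2.
have -> : psi l^-1 - k^-1 = (psi l^-1 * k - 1) / k by field.
rewrite normrM normfV kN invr1 mulr1.
have -> : psi l^-1 * k - 1 = (g * (psi l^-1 * k) - 1) - (g - 1) * (psi l^-1 * k) by ring.
rewrite (le_trans (ler_normB _ _))// [`|_ * (_ * k)|]normrM [`|_ * k|]normrM psiN kN !mulr1.
by rewrite [leRHS](splitr e) lerD.
Qed.

(** By [char_limit], [psi] has a limit at infinity. Both [t^-1] and [v + t^-1] are far out for small
    [t], so [psi v * psi t^-1] is close to [psi t^-1], which has modulus one. *)
Lemma additive_char_trivial v : psi v = 1.
Proof.
apply/eqP; rewrite -subr_eq0; apply/eqP/eps_eq0 => e e0.
have [d d0 H] := char_limit (divr_gt0 e0 (ltr0n _ 2)).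
(* The choice gives [|t * v| <= 1/4] and [t <= d/4], so that [t] and [t / (1 + t * v)], the inverse
   of [v + t^-1], both have modulus below [d]. *)
pose D : C := 1 + d * `|v|.
have D1 : 1 <= D by rewrite lerDl mulr_ge0// ltW.
have D0 : 0 < D by rewrite (lt_le_trans ltr01).
pose t : C := d / (4 * D).
have t0 : 0 < t by rewrite divr_gt0// mulr_gt0// ltr0n.
have tv : `|t * v| <= 4^-1.
  rewrite normrM (gtr0_norm t0) /t mulrAC ler_pdivrMr ?mulr_gt0 ?ltr0n//.
  by rewrite mulrA mulVf ?mul1r ?pnatr_eq0// lerDr ler01.
have td : t <= d / 4.
  by rewrite /t ler_pM2l// lef_pV2 ?posrE ?mulr_gt0 ?ltr0n// ler_peMr// ler0n.
have tv' : 2^-1 <= `|1 + t * v|.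
  have := lerB_normD 1 (t * v); rewrite normr1; apply: le_trans.
  rewrite lerBrDr -lerBrDl (le_trans tv)//.
  by rewrite lerBrDr -subr_ge0 (_ : _ - _ = 4^-1) ?invr_ge0 ?ler0n//; field.
have n0 : 1 + t * v != 0.
  by rewrite -normr_gt0 (lt_le_trans _ tv')// invr_gt0 ltr0n.
have tn : t != 0 by rewrite gt_eqF.
have d4 : d / 4 < d by rewrite ltr_pdivrMr ?ltr0n// ltr_pMr// ltr1n.
have h1 : `|psi t^-1 - (chi 2^-1 * 2)^-1| <= e / 2.
  by apply: H => //; rewrite (gtr0_norm t0) (le_lt_trans td).
have : `|psi (v + t^-1) - (chi 2^-1 * 2)^-1| <= e / 2.
  have -> : v + t^-1 = (t / (1 + t * v))^-1 by field; rewrite ?n0.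
  apply: H; first by rewrite (mulf_neq0 tn)// invr_eq0.
  rewrite normrM normfV (gtr0_norm t0) ltr_pdivrMr ?(lt_le_trans _ tv') ?invr_gt0 ?ltr0n//.
  rewrite (le_lt_trans td)// ltr_pM2l//.
  by rewrite (lt_le_trans _ tv')// ltf_pV2 ?posrE ?ltr0n// ltr_nat.
rewrite psiD => h2.
have -> : `|psi v - 1| = `|(psi v - 1) * psi t^-1| by rewrite normrM psiN mulr1.
rewrite mulrBl mul1r.
have -> : psi v * psi t^-1 - psi t^-1 = (psi v * psi t^-1 - (chi 2^-1 * 2)^-1) - (psi t^-1 -
  (chi 2^-1 * 2)^-1) by ring.
by rewrite (le_trans (ler_normB _ _))// [leRHS](splitr e) lerD.
Qed.

Lemma limit_norm e : 0 < e -> exists2 d, 0 < d & forall l, l != 0 -> `|l| < d ->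
  `|chi l * u / l - 1| <= e.
Proof.
move=> /lim[d d0 H]; exists d => // l l0 ld.
by have := H l l0 ld; rewrite additive_char_trivial mulr1.
Qed.

(** The quotients [chi l * u / l] at [l = t] and at [l = x * t] both tend to 1, and they differ by
    the factor [chi x / x]. *)
Lemma mult_char_id x : chi x = x.
Proof.
have [->|x0] := eqVneq x 0.
  by apply/eqP; rewrite -normr_eq0 chiN normr0.
suff /eqP : chi x / x - 1 = 0 by rewrite subr_eq0 => /eqP e; rewrite -[LHS](divfK x0) e mul1r.
apply: eps_eq0 => e e0.
have [d d0 H] := limit_norm (divr_gt0 e0 (ltr0n _ 2)).
have D0 : 0 < 2 * (1 + `|x|) by rewrite mulr_gt0 ?ltr0n// ltr_wpDr.
pose t : C := d / (2 * (1 + `|x|)).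
have t0 : 0 < t by rewrite divr_gt0.
have tn : t != 0 by rewrite gt_eqF.
have h1 : `|chi t * u / t - 1| <= e / 2.
  apply: H => //; rewrite gtr0_norm// ltr_pdivrMr// ltr_pMr//.
  by rewrite (lt_le_trans (_ : 1 < 2)) ?ltr1n// ler_peMr ?ler0n// lerDl.
have : `|chi (x * t) * u / (x * t) - 1| <= e / 2.
  apply: H; first by rewrite (mulf_neq0 x0).
  rewrite normrM (gtr0_norm t0) /t mulrA ltr_pdivrMr//.
  rewrite mulrC ltr_pM2l// mulrDr mulr1 ltr_pwDl ?ltr0n//.
  by rewrite ler_peMl// ler1n.
rewrite chiM => h2.
have gN : `|chi t * u / t| = 1.
  by rewrite normrM normfV normrM chiN uN mulr1 divff// normr_eq0.
have -> : `|chi x / x - 1| = `|(chi x / x - 1) * (chi t * u / t)|.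
  by rewrite normrM gN mulr1.
rewrite mulrBl mul1r.
have -> : chi x / x * (chi t * u / t) - chi t * u / t = (chi x * chi t * u / (x * t) - 1) -
  (chi t * u / t - 1) by field; rewrite ?x0 ?tn.
by rewrite (le_trans (ler_normB _ _))// [leRHS](splitr e) lerD.
Qed.

Lemma limit_unit : u = 1.
Proof.
apply/eqP; rewrite -subr_eq0; apply/eqP/eps_eq0 => e e0.
have [d d0 H] := limit_norm e0.
have d2 : 0 < d / 2 by rewrite divr_gt0 ?ltr0n.
have d2' : d / 2 != 0 by rewrite gt_eqF.
have := H _ d2'; rewrite mult_char_id (mulrC (d / 2)) mulfK//; apply.
by rewrite gtr0_norm// ltr_pdivrMr ?ltr0n// ltr_pMr// ltr1n.
Qed.

End Scalars.

(** * Multiplicative norm-preserving maps that fix the shift *)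

Section ShiftFixing.
Variables (C : numClosedFieldType) (m : nat).
Local Notation hS := (shift_poly m.+1).
Local Notation S := (@shift C m.+1).

(* The continuity clause only asks for continuity at [S] along the line [S + l]. *)
Definition admissible (psi : 'M[C]_m.+2 -> 'M[C]_m.+2) :=
  [/\ forall p q, psi (hS p *m hS q) = psi (hS p) *m psi (hS q),
      forall p s, bounded_by s (psi (hS p)) <-> bounded_by s (hS p),
      forall e : C, 0 < e -> exists2 d : C, 0 < d & forall l, `|l| < d ->
        bounded_by e (psi (hS ('X + l%:P)) - psi S)
    & psi S = S].

Definition lin (w : C) : {poly C} := 1 + w *: 'X.

Lemma lin0 w : (lin w)`_0 = 1.
Proof. by rewrite coefD coefZ coefX coef1 mulr0 addr0. Qed.

Lemma lin1 w : (lin w)`_1 = w.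
Proof. by rewrite coefD coefZ coefX coef1 mulr1 add0r. Qed.

Variable psi : 'M[C]_m.+2 -> 'M[C]_m.+2.
Hypothesis adm : admissible psi.

Let psiM p q : psi (hS (p * q)) = psi (hS p) *m psi (hS q).
Proof. by have [H _ _ _] := adm; rewrite shift_polyM H. Qed.

Let psiB p s : bounded_by s (psi (hS p)) <-> bounded_by s (hS p).
Proof. by have [_ H _ _] := adm. Qed.

Let psiX : psi (hS 'X) = hS 'X.
Proof. by have [_ _ _ H] := adm; rewrite shift_polyX. Qed.

Definition symbol p := topoly (psi (hS p)).

(** Since [psi] fixes S, the image of a matrix commuting with S commutes with S, and the commutant
    of S is the algebra itself. *)
Lemma symbolE p : psi (hS p) = hS (symbol p).
Proof.
apply: comm_shift; rewrite -shift_polyX -{1}psiX -{2}psiX -!psiM.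
by rewrite mulrC.
Qed.

Lemma symbol_mul p q k : (k < m.+2)%N -> (symbol (p * q))`_k = (symbol p * symbol q)`_k.
Proof. by move=> km; apply: (coef_shift_poly km); rewrite -symbolE psiM !symbolE shift_polyM. Qed.

Lemma psiXn k : (0 < k)%N -> psi (hS 'X^k) = hS 'X^k.
Proof.
case: k => // k _; elim: k => [|k IH]; first by rewrite expr1.
by rewrite exprS psiM IH psiX -shift_polyM.
Qed.

Lemma shift_poly_symbolXn k p : (0 < k)%N -> psi (hS ('X^k * p)) = hS ('X^k * symbol p).
Proof. by move=> k0; rewrite psiM psiXn// symbolE -shift_polyM. Qed.

(** Multiplication by S^(m+1), which [psi] fixes, isolates the constant term, whose modulus is then
    a norm. *)
Lemma symbol0_norm p : `|(symbol p)`_0| = `|p`_0|.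
Proof.
have E s : `|(symbol p)`_0| ^+ 2 <= s <-> `|p`_0| ^+ 2 <= s.
  by rewrite -!(bounded_by_Xn_corner m.+1) -shift_poly_symbolXn// psiB.
apply/eqP; rewrite eq_le; apply/andP; split; rewrite -ler_sqr ?nnegrE//.
- exact/E.
- exact/E.
Qed.

Definition chi c := (symbol c%:P)`_0.

Lemma chi_norm c : `|chi c| = `|c|.
Proof. by rewrite symbol0_norm coefC eqxx. Qed.

(* The last column of [psi c] has norm at most [|c|], and its bottom entry
   already has modulus [|c|]. *)
Lemma psi_scalar c : psi c%:M = (chi c)%:M.
Proof.
rewrite -(shift_polyC _ c) symbolE -(shift_polyC _ (chi c)); apply: shift_poly_eq => k km;
  rewrite coefC.
case: eqP => [->//|/eqP k0].
have : bounded_by (`|c| ^+ 2) (hS (symbol c%:P)).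
  by rewrite -symbolE psiB shift_polyC; apply: bounded_by_scalar.
move/bounded_by_coefs; rewrite (bigD1 0)//= (bigD1 (Ordinal km))//= chi_norm gerDl => le0.
have : `|(symbol c%:P)`_k| ^+ 2 == 0.
  rewrite eq_le exprn_ge0// andbT (le_trans _ le0)// lerDl.
  by apply: sumr_ge0 => i _; rewrite exprn_ge0.
by rewrite expf_eq0 /= normr_eq0 => /eqP.
Qed.

Lemma chiM x y : chi (x * y) = chi x * chi y.
Proof.
by rewrite /chi polyCM symbol_mul// coef0M.
Qed.

Lemma psi_Xn_mul k p : psi (hS ('X^k * p)) = hS ('X^k * symbol p).
Proof. by case: k => [|k]; [rewrite !mul1r symbolE|rewrite shift_poly_symbolXn]. Qed.

(** Multiplication by S^m passes through [psi] and erases all but the two lowest coefficients; hence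
    [psi] descends to the quotient modulo X^2. *)
Lemma symbol_low (p q : {poly C}) : p`_0 = q`_0 -> p`_1 = q`_1 ->
  (symbol p)`_0 = (symbol q)`_0 /\ (symbol p)`_1 = (symbol q)`_1.
Proof.
move=> e0 e1; have e : hS ('X^m * symbol p) = hS ('X^m * symbol q).
  rewrite -!psi_Xn_mul; congr psi; apply: shift_poly_eq => k km.
  rewrite !coefXnM; case: ltnP => // mk.
  by have [->|->] : (k - m = 0 \/ k - m = 1)%N by lia.
have := coef_shift_poly (leqnSn m.+1) e; have := coef_shift_poly (ltnSn m.+1) e.
by rewrite !coefXnM ltnn subnn ltnNge leqnSn subSn// subnn.
Qed.

Let p0 w := (symbol (lin w))`_0.
Let p1 w := (symbol (lin w))`_1.

(** Modulo X^2 the map [lin] turns sums into products; this is what makes [p0] an additive character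
    and [p1 / p0] additive. *)
Lemma lin_low x y : (lin x * lin y)`_0 = (lin (x + y))`_0 /\
  (lin x * lin y)`_1 = (lin (x + y))`_1.
Proof.
split; first by rewrite coef0M !lin0 mulr1.
by rewrite coefM !big_ord_recl big_ord0 /= !subn0 !lin0 !lin1 mul1r mulr1 addr0 addrC.
Qed.

Lemma symbol0_lin_norm w : `|p0 w| = 1.
Proof. by rewrite /p0 symbol0_norm lin0 normr1. Qed.

(** The corner blocks of [lin w] and of its symbol have the same bounds and unimodular diagonals, so
    [block_norm_le] applies in both directions. *)
Lemma symbol1_lin_norm w : `|p1 w| = `|w|.
Proof.
have := @block_norm_le _ m (lin w) (symbol (lin w)).
have := @block_norm_le _ m (symbol (lin w)) (lin w).
rewrite lin0 symbol0_lin_norm normr1 lin1 => h1 h2; apply/eqP.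
rewrite eq_le h1 ?h2//= => s; by rewrite -psi_Xn_mul => /psiB.
Qed.

Lemma symbol0_linD x y : p0 (x + y) = p0 x * p0 y.
Proof.
have [l0 l1] := lin_low x y; rewrite /p0 ?/p1; have [<- _] := symbol_low l0 l1.
by rewrite symbol_mul// coef0M.
Qed.

Lemma symbol1_linD x y : p1 (x + y) = p0 x * p1 y + p1 x * p0 y.
Proof.
have [l0 l1] := lin_low x y; rewrite /p0 ?/p1; have [_ <-] := symbol_low l0 l1.
by rewrite symbol_mul// coefM !big_ord_recl big_ord0 /= addr0.
Qed.

(** By the product rules for [p0] and [p1], the quotient [p1 / p0] is an additive isometry of the
    plane. *)
Lemma symbol1_lin_form : exists2 u, `|u| = 1 &
  (forall w, p1 w = p0 w * (u * w)) \/ (forall w, p1 w = p0 w * (u * w^*)).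
Proof.
have n0 w : p0 w != 0 by rewrite -normr_eq0 symbol0_lin_norm oner_eq0.
have e w : p1 w = p0 w * (p1 w / p0 w) by rewrite mulrC divfK.
have [x y|x|u u1 [h|h]] := @isometry_plane _ (fun w => p1 w / p0 w).
- by rewrite symbol1_linD symbol0_linD; field; rewrite !n0.
- by rewrite normrM normfV symbol0_lin_norm divr1 symbol1_lin_norm.
- by exists u => //; left => w; rewrite e h.
- by exists u => //; right => w; rewrite e h.
Qed.

Lemma symbol_low_order : (exists2 u, `|u| = 1 & forall w, p1 w = p0 w * (u * w)) ->
  [/\ forall c, chi c = c, forall w, p0 w = 1 & forall w, p1 w = w].
Proof.
move=> [u u1 hu].
have lim : forall e : C, 0 < e -> exists2 d : C, 0 < d & forall l, l != 0 -> `|l| < d ->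
    `|chi l * p0 l^-1 * u / l - 1| <= e.
  move=> e e0; have [_ _ cont _] := adm.
  (* The square appears because [bounded_by] measures squared norms. *)
  have [d d0 H] := cont _ (exprn_gt0 2 e0); exists d => // l l0 /H.
  rewrite -shift_polyX psiX symbolE -shift_polyB => /(bounded_by_coef (_ : 1 < m.+2)%N) => /(_
    isT).
  rewrite ler_sqr ?nnegrE ?(ltW e0)// coefB coefX.
  (* As S + l = l (1 + S / l) and the image of [l] is the scalar [chi l], the linear coefficient
     becomes [chi l * p1 l^-1]. *)
  have [_ ->] : (symbol ('X + l%:P))`_0 = (symbol (l%:P * lin l^-1))`_0 /\
      (symbol ('X + l%:P))`_1 = (symbol (l%:P * lin l^-1))`_1.
    apply: symbol_low; rewrite coefD coefX coefC coefCM ?lin0 ?lin1 /=.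
      by rewrite mulr1 add0r.
    by rewrite mulfV// addr0.
  rewrite symbol_mul// coefM !big_ord_recl big_ord0 /= addr0 !subn0.
  have -> : (symbol l%:P)`_1 = 0.
    have := psi_scalar l; rewrite -(shift_polyC _ l) symbolE -(shift_polyC _ (chi l)) =>
      /(coef_shift_poly (_ : 1 < m.+2)%N) => /(_ isT) ->.
    by rewrite coefC.
  by rewrite mul0r addr0 -/(p1 _) hu -/(chi _) !mulrA.
have H := additive_char_trivial chiM chi_norm symbol0_linD symbol0_lin_norm lim.
have H1 := mult_char_id chiM chi_norm symbol0_linD symbol0_lin_norm u1 lim.
have H2 := limit_unit chiM chi_norm symbol0_linD symbol0_lin_norm u1 lim.
by split=> // w; rewrite hu H H2 !mul1r.
Qed.

End ShiftFixing.

(** * A submultiplicative entrywise norm *)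

Section EntrySum.
Variables (C : numClosedFieldType) (n : nat).

Definition entry_sum (A : 'M[C]_n) : C := \sum_i \sum_j `|A i j|.

Lemma entry_sum_ge0 A : 0 <= entry_sum A.
Proof. by apply: sumr_ge0 => i _; apply: sumr_ge0. Qed.

Lemma entry_sumM A B : entry_sum (A *m B) <= entry_sum A * entry_sum B.
Proof.
rewrite /entry_sum mulr_suml; apply: ler_sum => i _.
apply: le_trans (_ : \sum_j \sum_k `|A i k| * `|B k j| <= _).
  apply: ler_sum => j _; rewrite mxE (le_trans (ler_norm_sum _ _ _))//.
  by apply: ler_sum => k _; rewrite normrM.
rewrite exchange_big mulr_suml /=; apply: ler_sum => k _.
rewrite -mulr_sumr ler_wpM2l// [leRHS](bigD1 k)//= lerDl.
by apply: sumr_ge0 => j _; apply: sumr_ge0.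
Qed.

Lemma entry_le_sum (A : 'M[C]_n) i j : `|A i j| <= entry_sum A.
Proof.
rewrite /entry_sum (bigD1 i)//= (bigD1 j)//= -addrA lerDl.
by rewrite addr_ge0// sumr_ge0// => k _; apply: sumr_ge0.
Qed.

Lemma entry_sum_le (A : 'M[C]_n) K : (forall i j, `|A i j| <= K) -> entry_sum A <= K *+ n *+ n.
Proof.
move=> H; have -> : K *+ n *+ n = \sum_(i < n) \sum_(j < n) K by rewrite !sumr_const !card_ord.
by apply: ler_sum => i _; apply: ler_sum.
Qed.

End EntrySum.

(** * Unipotent polynomials with bounded powers *)

Section Unipotent.
Variable C : numClosedFieldType.

Lemma coef_unipotent_exp (g : {poly C}) j k : g`_0 = 1 -> (0 < j)%N ->
  (forall i, (0 < i < j)%N -> g`_i = 0) ->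
  (forall i, (0 < i < j)%N -> (g ^+ k)`_i = 0) /\ (g ^+ k)`_j = g`_j *+ k.
Proof.
move=> g0 j0 gj; elim: k => [|k [IH1 IH2]].
  rewrite expr0 mulr0n coef1 gtn_eqF//; split=> // i /andP[i0 _].
  by rewrite coef1 gtn_eqF.
have gk0 : (g ^+ k)`_0 = 1.
  by elim: k {IH1 IH2} => [|k IH]; rewrite ?expr0 ?coef1// exprS coef0M g0 IH mulr1.
have E i : (0 < i <= j)%N -> (g ^+ k.+1)`_i = (g ^+ k)`_i + g`_i.
  case: i => // i /andP[_ ij]; rewrite exprS coefM big_ord_recl big_ord_recr /=.
  rewrite big1 => [|l _].
    by rewrite subn0 g0 mul1r subnn gk0 mulr1 add0r.
  by rewrite gj ?mul0r//= /bump /=; have := ltn_ord l; lia.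
split=> [i /andP[i0 ij]|]; first by rewrite E ?i0 1?ltnW// IH1 ?i0// gj ?i0// addr0.
by rewrite E ?j0 ?leqnn// IH2 mulrSr.
Qed.

(** The lowest nonzero coefficient above the constant term is multiplied by [k] in the power
    [g ^+ k], so it would outgrow any bound. *)
Lemma bounded_unipotent (g : {poly C}) n B : (forall x : C, exists k : nat, `|x| <= k%:R) ->
  g`_0 = 1 -> (forall k j, (j < n)%N -> `|(g ^+ k)`_j| <= B) ->
  forall j, (0 < j < n)%N -> g`_j = 0.
Proof.
move=> arch g0 gB j; elim/ltn_ind: j => j IH /andP[j0 jn].
apply/eqP; apply: contraT => gj0.
have gp : 0 < `|g`_j| by rewrite normr_gt0.
have [k Hk] := arch ((B + 1) / `|g`_j|).
have := gB k j jn.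
have [|_ ->] := coef_unipotent_exp k g0 j0.
  by move=> i /andP[i0 ij]; apply: IH => //; rewrite i0 (ltn_trans ij).
have B0 : 0 <= B by apply: le_trans (gB 0%N j jn); apply: normr_ge0.
rewrite normrMn -mulr_natr mulrC => h.
have : B + 1 <= k%:R * `|g`_j|.
  rewrite -ler_pdivrMr// (le_trans _ Hk)// real_ler_norm// ger0_real//.
  by rewrite divr_ge0// addr_ge0.
by move=> /le_trans/(_ h); rewrite gerDl ler10.
Qed.

End Unipotent.

(** * Blaschke factors of the shift *)

Section Blaschke.
Variables (C : numClosedFieldType) (m : nat).
Local Notation hS := (shift_poly m.+1).
Local Notation S := (@shift C m.+1).

(** The geometric series of (1 - a X)^-1, cut off where the powers of S vanish. *)
Definition geo (a : C) : {poly C} := \sum_(i < m.+2) (a *: 'X) ^+ i.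

Lemma coef_geo a k : (k < m.+2)%N -> (geo a)`_k = a ^+ k.
Proof.
move=> km; rewrite coef_sum (bigD1 (Ordinal km))//= big1 => [|i ik].
  by rewrite exprZn coefZ coefXn eqxx mulr1 addr0.
rewrite exprZn coefZ coefXn; case: eqP => [e|]; last by rewrite mulr0.
by case/eqP: ik; apply: val_inj.
Qed.

Lemma lin_geo a : hS (lin (- a) * geo a) = 1%:M.
Proof.
have -> : lin (- a) * geo a = 1 - (a *: 'X) ^+ m.+2.
  by rewrite -opprB subrX1 -mulNr opprB /lin scaleNr.
rewrite -shift_poly1; apply: shift_poly_eq => k km.
by rewrite coefB exprZn coefZ coefXn ltn_eqF// mulr0 subr0.
Qed.

(** The Moebius function (z - a) / (1 - a^* z) evaluated at S. *)
Definition blaschke (a : C) := ('X - a%:P) * geo a^*.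

Lemma blaschkeM a : hS (blaschke a * lin (- a^*)) = hS ('X - a%:P).
Proof.
by rewrite /blaschke -mulrA [geo _ * _]mulrC shift_polyM lin_geo mulmx1.
Qed.

Lemma shift_poly_lin w : hS (lin w) = 1%:M + w *: S.
Proof. by rewrite shift_polyD shift_poly1 -mul_polyC shift_polyM shift_polyC shift_polyX
  mul_scalar_mx. Qed.

(** With x = (1 - a^* S)^-1 v, the squared norms of x - a^* S x and S x - a x differ by (1 - |a|^2)
    |x_0|^2. *)
Lemma bounded_by_blaschke a : `|a| <= 1 -> bounded_by 1 (hS (blaschke a)).
Proof.
move=> a1 v; rewrite mul1r; set x := hS (geo a^*) *m v.
have -> : hS (blaschke a) *m v = S *m x + (- a) *: x.
  by rewrite shift_polyM -mulmxA shift_polyB shift_polyX shift_polyC mulmxBl mul_scalar_mx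
    scaleNr.
have -> : sqnorm v = sqnorm (x + (- a^*) *: (S *m x)).
  by congr sqnorm; rewrite scalemxAl -{1}[x]mul1mx -mulmxDl -shift_poly_lin mulmxA
    -shift_polyM lin_geo mul1mx.
rewrite !sqnorm_addZ (innerC (S *m x)) -subr_ge0.
rewrite !normrN norm_conjC.
have -> : (- a^* * (inner x (S *m x))^*) = (- a * inner x (S *m x))^*.
  by rewrite rmorphM rmorphN.
rewrite conjCK; set z := _ * inner _ _; rewrite sqnorm_shift.
set r := `|x 0 0| ^+ 2.
have -> : sqnorm x + z^* + z + `|a| ^+ 2 * (sqnorm x - r) -
   (sqnorm x - r + z + z^* + `|a| ^+ 2 * sqnorm x) = (1 - `|a| ^+ 2) * r by ring.
by rewrite mulr_ge0 ?exprn_ge0// subr_ge0 exprn_ile1.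
Qed.

(* Such a contraction is isometric on [e_1 - a^* e_0], so its later columns
   are orthogonal to the image of that vector. *)
Lemma blaschke_rigid (B : {poly C}) a : bounded_by 1 (hS B) ->
  B`_0 = - a -> B`_1 = 1 - `|a| ^+ 2 -> hS (B * lin (- a^*)) = hS ('X - a%:P).
Proof.
move=> bB B0 B1; apply: shift_poly_eq => k km.
rewrite /lin mulrDr mulr1 coefD -scalerAr coefZ coefMX coefB coefX coefC.
case: k km => [|[|k]] km /=; first by rewrite B0 mulr0 addr0 sub0r.
  by rewrite B1 B0 normCK; ring.
pose o1 : 'I_m.+2 := lift ord0 ord0.
pose y : 'cV[C]_m.+2 := delta_mx (Ordinal km) 0.
pose x : 'cV[C]_m.+2 := delta_mx o1 0 + (- a^*) *: delta_mx 0 0.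
(* The vector e_1 - a^* e_0 is sent to e_0 - a e_1, which has the same norm. *)
have Bx i : (hS B *m x) i 0 = if i == 0 then 1 else if i == o1 then - a else 0.
  rewrite mulmxDr -scalemxAr -!colE !mxE !shift_polyE.
  case: i => [[|[|i]] im] //=; rewrite -?val_eqE /= /bump /=.
  - by rewrite B1 B0 normCK; ring.
  - by rewrite subnn B0 mulr0 addr0.
  - by rewrite mulr0 addr0.
have ex : sqnorm (hS B *m x) = sqnorm x.
  rewrite /sqnorm !big_ord_recl !Bx /= !big1 ?addr0.
  - rewrite !mxE /= normr1 mulr0 addr0 normr1 add0r mulr1 !normrN norm_conjC.
    by rewrite expr1n addrC.
  - by move=> i _; rewrite !mxE /= mulr0 addr0 normr0 expr0n.
  - by move=> i _; rewrite Bx /= normr0 expr0n.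
(* Orthogonality of a later column to e_0 - a e_1 reads B_k - a^* B_(k-1) = 0, the vanishing of the
   coefficient in question. *)
have := contraction_inner y bB ex.
have -> : inner y x = 0.
  rewrite /inner big1// => i _; rewrite !mxE.
  have [->|] := eqVneq i (Ordinal km); last by rewrite mul0r.
  have -> : (Ordinal km == o1) = false by [].
  have -> : (Ordinal km == 0) = false by [].
  by rewrite /= mulr0 addr0 rmorph0 mulr0.
rewrite /inner !big_ord_recl !Bx /= big1 => [|i _]; last by rewrite Bx /= rmorph0 mulr0.
rewrite -colE !mxE !shift_polyE /= subn0 rmorph1 mulr1 rmorphN addr0 /bump /= subSS subn0.
by move=> e; rewrite subr0 [- a^* * _]mulrC.
Qed.

End Blaschke.

(** * From the identity on low coefficients to the identity *)

Section Identity.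
Variables (C : numClosedFieldType) (m : nat).
Local Notation hS := (shift_poly m.+1).
Local Notation S := (@shift C m.+1).
Local Notation geo := (@geo C m).
Local Notation entry_sum := (@entry_sum C m.+2).

Variable psi : 'M[C]_m.+2 -> 'M[C]_m.+2.
Hypothesis arch : forall x : C, exists k : nat, `|x| <= k%:R.
Hypothesis adm : admissible psi.
Hypothesis low : [/\ forall c, chi psi c = c,
  forall w, (symbol psi (lin w))`_0 = 1 & forall w, (symbol psi (lin w))`_1 = w].

Let psiM p q : psi (hS (p * q)) = psi (hS p) *m psi (hS q).
Proof. by have [H _ _ _] := adm; rewrite shift_polyM H. Qed.

Let psiC c : psi (hS c%:P) = hS c%:P.
Proof. by have [H _ _] := low; rewrite shift_polyC psi_scalar// H. Qed.

Let psiE p : psi (hS p) = hS (symbol psi p).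
Proof. exact: symbolE. Qed.

Lemma symbol_Cmul c q k : (k < m.+2)%N -> (symbol psi (c%:P * q))`_k = c * (symbol psi q)`_k.
Proof.
move=> km; rewrite -coefCM; apply: (coef_shift_poly km).
by rewrite -psiE psiM psiC psiE shift_polyM.
Qed.

Lemma symbol_low_id (p : {poly C}) : p`_0 != 0 ->
  (symbol psi p)`_0 = p`_0 /\ (symbol psi p)`_1 = p`_1.
Proof.
move=> p0; have [_ l0 l1] := low.
have [||e0 e1] := @symbol_low _ _ psi adm p ((p`_0)%:P * lin (p`_1 / p`_0)).
- by rewrite coefCM lin0 mulr1.
- by rewrite coefCM lin1 mulrC divfK.
by rewrite e0 e1 !symbol_Cmul// l0 l1 mulr1 mulrC divfK.
Qed.

(** The image is again a contraction with the same two lowest coefficients, so [blaschke_rigid]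
    identifies it. *)
Lemma psi_blaschke a : a != 0 -> `|a| <= 1 ->
  psi (hS (blaschke m a)) *m hS (lin (- a^*)) = hS ('X - a%:P).
Proof.
move=> a0 a1; have g0 := @coef_geo _ m a^* 0 isT; have g1 := @coef_geo _ m a^* 1 isT.
have b0 : (blaschke m a)`_0 = - a.
  by rewrite coef0M coefB coefX coefC g0 /= expr0 mulr1 sub0r.
have b1 : (blaschke m a)`_1 = 1 - `|a| ^+ 2.
  rewrite coefM !big_ord_recl big_ord0 /= !coefB !coefX !coefC /= subn0 subnn g0 g1.
  by rewrite normCK expr0 expr1; ring.
have [|f0 f1] := @symbol_low_id (blaschke m a); first by rewrite b0 oppr_eq0.
rewrite psiE -shift_polyM; apply: blaschke_rigid; rewrite ?f0 ?f1//.
by rewrite -psiE; have [_ H _ _] := adm; apply/H/bounded_by_blaschke.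
Qed.

(* The symbol of [psi (lin w) * (lin w)^-1]. *)
Definition ratio w : {poly C} := symbol psi (lin w) * geo (- w).

Lemma geo_lin w : hS (geo (- w) * lin w) = 1%:M.
Proof. by rewrite -{2}[w]opprK mulrC lin_geo. Qed.

Lemma ratio_lin w : psi (hS (lin w)) = hS (ratio w) *m hS (lin w).
Proof. by rewrite -shift_polyM /ratio -mulrA shift_polyM geo_lin mulmx1 psiE. Qed.

Lemma XsubC_lin (a : C) : a != 0 -> 'X - a%:P = (- a)%:P * lin (- a^-1).
Proof.
move=> a0; rewrite /lin mulrDr mulr1 -scalerAr mul_polyC scalerA mulrNN mulVf//.
by rewrite scale1r polyCN addrC.
Qed.

Lemma ratio_XsubC a : a != 0 ->
  psi (hS ('X - a%:P)) = hS (ratio (- a^-1)) *m hS ('X - a%:P).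
Proof.
move=> a0; rewrite XsubC_lin// psiM psiC ratio_lin (@shift_polyM _ _ (- a)%:P) !mulmxA; congr
  (_ *m _).
exact: shift_poly_comm.
Qed.

Lemma XsubC_inv (a : C) : a != 0 -> exists q, hS (('X - a%:P) * q) = 1%:M.
Proof.
move=> a0; exists (geo a^-1 * (- a^-1)%:P); rewrite XsubC_lin//.
have -> : (- a)%:P * lin (- a^-1) * (geo a^-1 * (- a^-1)%:P) =
    (- a * - a^-1)%:P * (lin (- a^-1) * geo a^-1) by rewrite polyCM; ring.
by rewrite mulrNN divff// mul1r lin_geo.
Qed.

(** S - a is a scalar multiple of 1 - S / a, and it is also 1 - a^* S times a Blaschke matrix fixed
    by [psi]. The two resulting values of [psi (S - a)] are compared and the invertible S - a is
    cancelled. *)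
Lemma ratio_swap a : a != 0 -> `|a| <= 1 -> hS (ratio (- a^-1)) = hS (ratio (- a^*)).
Proof.
move=> a0 a1; have [q Hq] := XsubC_inv a0.
rewrite -[LHS]mulmx1 -[RHS]mulmx1 -Hq (@shift_polyM _ _ ('X - a%:P)) !mulmxA; congr (_ *m _).
rewrite -ratio_XsubC// -{1}(blaschkeM m a) psiM ratio_lin psiE.
by rewrite mulmxA (shift_poly_comm _ _ (ratio _)) -mulmxA -psiE psi_blaschke.
Qed.

Lemma bounded_by_lin (w : C) : `|w| <= 1 -> bounded_by 4 (hS (lin w)).
Proof.
move=> w1 v; rewrite shift_poly_lin mulmxDl mul1mx -scalemxAl.
have -> : 4 * sqnorm v = 2 * sqnorm v + 2 * sqnorm v by ring.
rewrite (le_trans (sqnormD_le _ _))// sqnormZ lerD2l.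
rewrite ler_pM2l ?ltr0n// (le_trans (_ : _ <= `|w| ^+ 2 * sqnorm v))//.
  by rewrite ler_wpM2l ?exprn_ge0// -[leRHS]mul1r bounded_by_shift.
by rewrite ler_piMl ?sqnorm_ge0// exprn_ile1.
Qed.

Lemma entry_sum_shift_poly (p : {poly C}) K : 0 <= K ->
  (forall k, (k < m.+2)%N -> `|p`_k| <= K) -> entry_sum (hS p) <= K *+ m.+2 *+ m.+2.
Proof.
move=> K0 H; apply: entry_sum_le => i j; rewrite shift_polyE; case: ifP => _.
  by rewrite H// (leq_ltn_trans (leq_subr _ _)).
by rewrite normr0.
Qed.

(** On the closed unit disc norm preservation gives a bound; outside it [ratio_swap] reflects [w] in
    the unit circle. *)
Lemma ratio_bounded : exists2 K, 1 <= K & forall w, entry_sum (hS (ratio w)) <= K.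
Proof.
(* Here 2 bounds the coefficients of the symbol of [lin w] and 1 those of the geometric series, for
   [w] in the unit disc. *)
pose K0 : C := (2 *+ m.+2 *+ m.+2) * (1 *+ m.+2 *+ m.+2).
have K00 : 0 <= K0 by rewrite mulr_ge0// !mulrn_wge0// ler0n.
have K1 w : `|w| <= 1 -> entry_sum (hS (ratio w)) <= K0.
  move=> w1; rewrite shift_polyM (le_trans (entry_sumM _ _))//.
  apply: ler_pM; rewrite ?entry_sum_ge0//.
    apply: entry_sum_shift_poly; rewrite ?ler0n// => k km.
    rewrite -ler_sqr ?nnegrE ?ler0n//; apply: (bounded_by_coef km).
    rewrite -psiE; have [_ H _ _] := adm; apply/H.
    by rewrite -natrX; apply: bounded_by_lin.
  apply: entry_sum_shift_poly => // k km.
  by rewrite coef_geo// normrX normrN exprn_ile1.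
exists (1 + K0); first by rewrite lerDl.
move=> w; apply: le_trans (_ : K0 <= _); last by rewrite lerDr ler01.
have [w1|w1] := real_leP (normr_real w) (real1 C); first exact: K1.
have w0 : w != 0 by rewrite -normr_gt0 (lt_trans ltr01).
have a1 : `|- w^-1| <= 1 by rewrite normrN normfV invf_le1 ?ltW// normr_gt0.
have := @ratio_swap (- w^-1); rewrite oppr_eq0 invr_eq0 w0 => /(_ isT a1).
rewrite invrN invrK opprK => ->; apply: K1.
by rewrite normrN norm_conjC.
Qed.

(** Each linear factor contributes one [ratio] and one factor [K], so the bound depends on the
    number of roots and not on their location. *)
Lemma psi_prod_XsubC K (r : seq C) : (forall w, entry_sum (hS (ratio w)) <= K) ->
  all (fun z => z != 0) r -> exists2 g,
    psi (hS (\prod_(z <- r) ('X - z%:P))) = hS g *m hS (\prod_(z <- r) ('X - z%:P))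
    & entry_sum (hS g) <= 1 *+ m.+2 *+ m.+2 * K ^+ size r.
Proof.
move=> HK; elim: r => [_|z r IH /= /andP[z0 /IH[g gE gK]]].
  exists 1; rewrite ?big_nil; first by rewrite -polyC1 psiC polyC1 shift_poly1 mulmx1.
  rewrite expr0 mulr1; apply: entry_sum_shift_poly => // k _.
  by rewrite coef1; case: eqP => _; rewrite ?normr1 ?normr0.
exists (ratio (- z^-1) * g).
  rewrite big_cons psiM ratio_XsubC// gE (@shift_polyM _ _ (ratio _)) (@shift_polyM _ _ ('X - _)).
  rewrite -!mulmxA; congr (_ *m _); rewrite !mulmxA; congr (_ *m _); exact: shift_poly_comm.
rewrite shift_polyM (le_trans (entry_sumM _ _))// exprS mulrCA.
by apply: ler_pM; rewrite ?entry_sum_ge0.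
Qed.

Lemma shift_poly_exp1 (p : {poly C}) k : hS p = 1%:M -> hS (p ^+ k) = 1%:M.
Proof. by move=> e; elim: k => [|k IH]; rewrite ?shift_poly1// exprS shift_polyM e IH mulmx1. Qed.

Lemma psi_lin_exp w k : psi (hS (lin w ^+ k)) = hS (ratio w ^+ k) *m hS (lin w ^+ k).
Proof.
elim: k => [|k IH]; first by rewrite !expr0 -polyC1 psiC polyC1 shift_poly1 mulmx1.
rewrite !exprS psiM IH ratio_lin (@shift_polyM _ _ (ratio w)) (@shift_polyM _ _ (lin w)).
rewrite -!mulmxA; congr (_ *m _); rewrite !mulmxA; congr (_ *m _).
exact: shift_poly_comm.
Qed.

(* Modulo [X^n] any power of [lin w] is a product of fewer than [n] linear
   factors, so the bound does not depend on the exponent. *)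
Lemma ratio_exp_bounded w : exists B, forall k j, (j < m.+2)%N -> `|(ratio w ^+ k)`_j| <= B.
Proof.
have [K K1 HK] := ratio_bounded.
exists (1 *+ m.+2 *+ m.+2 * K ^+ m.+2) => k j jm.
have [q [qE q0 qs]] : exists q : {poly C},
    [/\ hS q = hS (lin w ^+ k), q`_0 = 1 & (size q <= m.+2)%N].
  exists (take_poly m.+2 (lin w ^+ k)); split; last exact: size_take_poly.
    by apply: shift_poly_eq => i im; rewrite coef_take_poly im.
  rewrite coef_take_poly /=; elim: k => [|k IH]; first by rewrite expr0 coef1.
  by rewrite exprS coef0M IH lin0 mulr1.
have [r rE] := closed_field_poly_normal q.
have l0 : lead_coef q != 0.
  by rewrite lead_coef_eq0; apply/eqP => e; move/eqP: q0; rewrite e coef0 eq_sym oner_eq0.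
have rs : (size r <= m.+2)%N.
  by apply: leq_trans qs; rewrite rE size_scale// size_prod_XsubC.
(* The constant term 1 excludes the root 0. *)
have r0 : all (fun z => z != 0) r.
  apply/allP => z zr; apply/eqP => z0; move/eqP: q0.
  rewrite -horner_coef0 rE hornerZ -z0; have := root_prod_XsubC r z.
  by rewrite zr => /rootP ->; rewrite mulr0 eq_sym oner_eq0.
have [g gE gK] := psi_prod_XsubC HK r0.
have eg : hS (ratio w ^+ k) = hS g.
  have : psi (hS q) = hS g *m hS q.
    rewrite rE -mul_polyC psiM gE psiC shift_polyM !mulmxA; congr (_ *m _).
    exact: shift_poly_comm.
  (* Both expressions for [psi (hS q)] end in the same invertible matrix, which the power of
     [geo (- w)] cancels. *)
  rewrite qE psi_lin_exp => /(congr1 (mulmx^~ (hS (geo (- w) ^+ k)))).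
  have gl : hS ((lin w * geo (- w)) ^+ k) = 1%:M by rewrite shift_poly_exp1// mulrC geo_lin.
  by rewrite -!mulmxA -shift_polyM -exprMn gl !mulmx1.
have -> : (ratio w ^+ k)`_j = hS (ratio w ^+ k) 0 (inord j).
  by rewrite shift_polyE leq0n subn0 inordK.
rewrite (le_trans (entry_le_sum _ _ _))// eg (le_trans gK)//.
by rewrite ler_wpM2l ?mulrn_wge0 ?ler01// ler_weXn2l.
Qed.

Lemma psi_lin w : psi (hS (lin w)) = hS (lin w).
Proof.
have [B HB] := ratio_exp_bounded w.
have [_ l0 _] := low.
have r0 : (ratio w)`_0 = 1 by rewrite coef0M l0 coef_geo// expr0 mulr1.
have r1 := bounded_unipotent arch r0 HB.
rewrite ratio_lin; have -> : hS (ratio w) = hS 1; last by rewrite shift_poly1 mul1mx.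
apply: shift_poly_eq => k km; rewrite coef1; case: eqP => [->//|/eqP k0].
by apply: r1; rewrite km lt0n k0.
Qed.

Lemma psi_id p : psi (hS p) = hS p.
Proof.
have [r ->] := closed_field_poly_normal p.
rewrite -mul_polyC psiM psiC [RHS]shift_polyM; congr (_ *m _).
elim: r => [|z r IH]; first by rewrite big_nil -polyC1 psiC.
rewrite big_cons psiM IH [RHS]shift_polyM; congr (_ *m _).
(* The root 0 gives the factor S, fixed by assumption; any other factor is a scalar times
   [lin (- z^-1)]. *)
have [->|z0] := eqVneq z 0.
  by rewrite subr0 shift_polyX; have [_ _ _ ->] := adm.
by rewrite XsubC_lin// psiM psiC psi_lin -shift_polyM.
Qed.

End Identity.

(** * Unitary equivalence to the shift *)

Section Rigidity.
Variables (C : numClosedFieldType) (m : nat).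
Local Notation hS := (shift_poly m.+1).
Local Notation S := (@shift C m.+1).
Local Notation conjmx A := (map_mx Num.conj A).

Hypothesis arch : forall x : C, exists k : nat, `|x| <= k%:R.

Lemma conjmxK (A : 'M[C]_m.+2) : conjmx (conjmx A) = A.
Proof. by apply/matrixP => i j; rewrite !mxE /= conjCK. Qed.

Lemma admissible_conj (psi : 'M[C]_m.+2 -> 'M[C]_m.+2) :
  admissible psi -> admissible (fun A => conjmx (psi A)).
Proof.
case=> hM hB hc hX; split=> [p q|p s|e e0|].
- by rewrite hM map_mxM.
- split=> [/bounded_by_conj|b]; first by rewrite conjmxK => /hB.
  by apply/bounded_by_conj/hB.
- have [d d0 H] := hc e e0; exists d => // l /H /bounded_by_conj.
  by rewrite map_mxB.
- by rewrite hX conj_shift.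
Qed.

Lemma admissible_id_or_conj (psi : 'M[C]_m.+2 -> 'M[C]_m.+2) : admissible psi ->
  (forall p, psi (hS p) = hS p) \/ (forall p, psi (hS p) = conjmx (hS p)).
Proof.
move=> adm; have [u u1 [h|h]] := symbol1_lin_form adm.
  left=> p; apply: psi_id => //; apply: symbol_low_order => //.
  by exists u.
(* Entrywise conjugation turns the antilinear form of the linear coefficient into the linear one,
   with [u] replaced by its conjugate. *)
right=> p; have adm' := admissible_conj adm.
suff : conjmx (psi (hS p)) = hS p by move=> {2}<-; rewrite conjmxK.
apply: (psi_id arch adm'); apply: symbol_low_order => //; exists u^*; first by rewrite norm_conjC.
have E q k : (k < m.+2)%N -> (symbol (fun A => conjmx (psi A)) q)`_k = ((symbol psi q)`_k)^*.
  by move=> km; rewrite !coef_poly km mxE.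
by move=> w; rewrite !E// h !rmorphM /= conjCK.
Qed.

Variable phi : 'M[C]_m.+2 -> 'M[C]_m.+2.
Hypothesis phiM : forall p q, phi (hS p *m hS q) = phi (hS p) *m phi (hS q).
Hypothesis phiB : forall p s, bounded_by s (phi (hS p)) <-> bounded_by s (hS p).
Hypothesis phi_cont : forall e : C, 0 < e -> exists2 d : C, 0 < d &
  forall l, `|l| < d -> bounded_by e (phi (hS ('X + l%:P)) - phi S).
Hypothesis attained : forall A : 'M[C]_m.+2, exists2 v, sqnorm v = 1 &
  bounded_by (sqnorm (A *m v)) A.

Let T := phi S.

Lemma phiXn k : phi (hS 'X^(k.+1)) = T ^+ k.+1.
Proof.
elim: k => [|k IH]; first by rewrite !expr1 shift_polyX.
by rewrite exprS shift_polyM phiM IH shift_polyX [RHS]exprS.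
Qed.

Lemma phi_shift_nilpotent : T ^+ m.+2 = 0.
Proof.
rewrite -phiXn; apply/bounded_by0/phiB => v; rewrite mul0r.
have -> : hS ('X^(m.+2) : {poly C}) = hS 0.
  by apply: shift_poly_eq => k km; rewrite coefXn coef0 ltn_eqF.
by rewrite shift_poly0 mul0mx sqnorm0.
Qed.

Lemma phi_shift_contraction : bounded_by 1 T.
Proof. by rewrite /T -shift_polyX; apply/phiB; rewrite shift_polyX; apply: bounded_by_shift. Qed.

(** T^(m+1) is the image of S^(m+1), which has an entry 1, so the squared norm attained is at least
    one. *)
Lemma norming_vector : exists2 v, sqnorm v = 1 & 1 <= sqnorm (T ^+ m.+1 *m v).
Proof.
have [v v1 Hv] := attained (T ^+ m.+1); exists v => //.
have : bounded_by (sqnorm (T ^+ m.+1 *m v)) (hS 'X^(m.+1)) by apply/phiB; rewrite phiXn.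
by move=> /(bounded_by_coef (ltnSn m.+1)); rewrite coefXn eqxx normr1 expr1n.
Qed.

(* The orbit [v, T v, ..., T^(n-1) v] is an orthonormal basis in which [T] is the shift. *)
Lemma unitary_shift : exists2 U : 'M[C]_m.+2, adj U *m U = 1%:M & T *m U = U *m S.
Proof.
have [v v1 Mv] := norming_vector; have cT := phi_shift_contraction.
pose u k := T ^+ k *m v.
have uS k : T *m u k = u k.+1 by rewrite /u exprS mulmxA.
have u_out k : (m.+1 < k)%N -> u k = 0.
  by move=> mk; rewrite /u -(subnK mk) exprD phi_shift_nilpotent mulr0 mul0mx.
have u_le k d : sqnorm (u (k + d)%N) <= sqnorm (u k).
  elim: d => [|d IH]; rewrite ?addn0// addnS -uS (le_trans _ IH)//.
  by rewrite -[leRHS]mul1r cT.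
(* The norms decrease along the orbit, starting at 1 and ending at a value of at least 1. *)
have u1 k : (k <= m.+1)%N -> sqnorm (u k) = 1.
  move=> km; apply: le_anti; apply/andP; split.
    by have := u_le 0%N k; rewrite add0n {2}/u expr0 mul1mx v1.
  have := u_le k (m.+1 - k)%N; rewrite subnKC//; exact: le_trans.
(* [contraction_inner] advances both indices by one without changing the inner product; once [k]
   reaches m + 1 the other vector is zero. The induction runs on the distance [d] to that end. *)
have orth d i k : (k + d = m.+1)%N -> (k < i)%N -> inner (u i) (u k) = 0.
  elim: d i k => [|d IH] i k kd ki.
    rewrite u_out; last by rewrite -kd addn0.
    by rewrite /inner big1// => j _; rewrite mxE mul0r.
  rewrite -(@contraction_inner _ _ T) ?uS ?u1//; first by apply: IH => //; lia.
  - by lia.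
  - by lia.
(* The orbit is listed backwards because S lowers the index of a basis vector while T raises that of
   [u]. *)
exists (\matrix_(i, j) u (m.+1 - j)%N i 0).
  apply/matrixP => i j; rewrite !mxE.
  transitivity (inner (u (m.+1 - j)%N) (u (m.+1 - i)%N)).
    by apply: eq_bigr => k _; rewrite !mxE mulrC.
  case: (ltngtP i j) => ij.
  - rewrite innerC (orth j); [|have := ltn_ord j; lia|have := ltn_ord j; lia].
    by rewrite rmorph0 -val_eqE /= ltn_eqF.
  - rewrite (orth i); [|have := ltn_ord i; lia|have := ltn_ord i; lia].
    by rewrite -val_eqE /= gtn_eqF.
  - by rewrite (val_inj ij) -sqnorm_inner u1 ?eqxx ?leq_subr.
apply/matrixP => i j; rewrite mulmx_shift.
have -> : (T *m \matrix_(i, j) u (m.+1 - j)%N i 0) i j = (T *m u (m.+1 - j)%N) i 0.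
  by rewrite !mxE; apply: eq_bigr => k _; rewrite mxE.
rewrite uS; case: eqVneq => [->|j0]; first by rewrite subn0 u_out// mxE.
have jk : (0 < j)%N by rewrite lt0n.
rewrite [RHS]mxE inordK ?(leq_ltn_trans (leq_pred _))//.
congr (u _ _ _); have := ltn_ord j; lia.
Qed.

Theorem shift_algebra_rigidity : exists2 U : 'M[C]_m.+2, adj U *m U = 1%:M &
  (forall p, phi (hS p) = U *m hS p *m adj U) \/
  (forall p, phi (hS p) = U *m conjmx (hS p) *m adj U).
Proof.
have [U UU TU] := unitary_shift; have UU' := mulmx1C UU.
pose psi A := adj U *m phi A *m U.
have phiE A : phi A = U *m psi A *m adj U.
  by rewrite /psi -!mulmxA UU' mulmx1 mulmxA UU' mul1mx.
have psiS : psi S = S by rewrite /psi -mulmxA TU mulmxA UU mul1mx.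
have adm : admissible psi.
  split=> // [p q|p s|e e0].
  - by rewrite /psi phiM !mulmxA -(mulmxA _ U) UU' mulmx1.
  - by rewrite bounded_by_adj// phiB.
  - have [d d0 H] := phi_cont e0; exists d => // l /H.
    by rewrite /psi -mulmxBl -mulmxBr => b; apply/bounded_by_adj.
exists U => //; have [h|h] := admissible_id_or_conj adm; [left|right] => p.
- by rewrite phiE h.
- by rewrite phiE h.
Qed.

End Rigidity.

(** * Attainment of the operator norm *)

Section Attainment.
Variables (R : realType) (n : nat).
Local Notation C := (complex R).
Local Open Scope complex_scope.
Local Open Scope classical_set_scope.

Lemma continuous_sum (T : topologicalType) (I : Type) (r : seq I) (f : I -> T -> R) :
  (forall i, continuous (f i)) -> continuous (fun x => \sum_(i <- r) f i x).
Proof.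
move=> fc; elim: r => [|i r IH].
  by under eq_fun do rewrite big_nil; exact: cst_continuous.
under eq_fun do rewrite big_cons.
by move=> x; apply: cvgD; [exact: fc|exact: IH].
Qed.

Lemma continuous_fM (T : topologicalType) (f g : T -> R) :
  continuous f -> continuous g -> continuous (fun x => f x * g x).
Proof. by move=> fc gc x; apply: cvgM; [exact: fc|exact: gc]. Qed.

Lemma continuous_fD (T : topologicalType) (f g : T -> R) :
  continuous f -> continuous g -> continuous (fun x => f x + g x).
Proof. by move=> fc gc x; apply: cvgD; [exact: fc|exact: gc]. Qed.

Lemma continuous_fB (T : topologicalType) (f g : T -> R) :
  continuous f -> continuous g -> continuous (fun x => f x - g x).
Proof. by move=> fc gc x; apply: cvgB; [exact: fc|exact: gc]. Qed.

(** Real parts fill the first half and imaginary parts the second, so that the extreme value theorem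
    on real row vectors applies. *)
Definition cvec (x : 'rV[R]_(n.+1 + n.+1)) : 'cV[C]_n.+1 :=
  \col_j (x 0 (lshift n.+1 j) +i* x 0 (rshift n.+1 j)).

Lemma cvec_surj w : exists x, cvec x = w.
Proof.
exists (row_mx (\row_j complex.Re (w j 0)) (\row_j complex.Im (w j 0))).
apply/colP => j; rewrite mxE row_mxEl row_mxEr !mxE.
by case: (w j 0).
Qed.

Lemma sqnorm_ReIm k (w : 'cV[C]_k) : sqnorm w = (\sum_i (complex.Re (w i 0) ^+ 2 + complex.Im
  (w i 0) ^+ 2))%:C.
Proof. by rewrite rmorph_sum; apply: eq_bigr => i _; rewrite -add_Re2_Im2. Qed.

Lemma sqnorm_cvec x : sqnorm (cvec x) = (\sum_k x 0 k ^+ 2)%:C.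
Proof.
rewrite sqnorm_ReIm big_split_ord big_split /=; congr ((_ + _)%:C);
  by apply: eq_bigr => i _; rewrite mxE.
Qed.

Lemma continuous_sqnorm_mulmx (A : 'M[C]_n.+1) :
  exists2 F : 'rV[R]_(n.+1 + n.+1) -> R, continuous F &
    forall x, sqnorm (A *m cvec x) = (F x)%:C.
Proof.
exists (fun x => \sum_i (complex.Re ((A *m cvec x) i 0) ^+ 2 + complex.Im ((A *m cvec x) i 0)
  ^+ 2));
  last by move=> x; rewrite sqnorm_ReIm.
(* [a i] and [b i] are the real and imaginary parts of coordinate [i] of the image, as real linear
   forms. *)
pose a i (x : 'rV[R]_(n.+1 + n.+1)) := \sum_j (complex.Re (A i j) * x 0 (lshift n.+1 j)
   - complex.Im (A i j) * x 0 (rshift n.+1 j)).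
pose b i (x : 'rV[R]_(n.+1 + n.+1)) := \sum_j (complex.Re (A i j) * x 0 (rshift n.+1 j)
   + complex.Im (A i j) * x 0 (lshift n.+1 j)).
have cZ (c : R) k : continuous (fun x : 'rV[R]_(n.+1 + n.+1) => c * x 0 k).
  by apply: continuous_fM; [move=> x; exact: cst_continuous|exact: coord_continuous].
have ac i : continuous (a i).
  by apply: continuous_sum => j; apply: continuous_fB; exact: cZ.
have bc i : continuous (b i).
  by apply: continuous_sum => j; apply: continuous_fD; exact: cZ.
have e i x : (A *m cvec x) i 0 = a i x +i* b i x.
  rewrite mxE /a /b.
  elim/big_ind3: _ => [//|x1 x2 x3 y1 y2 y3 -> ->//|j _].
  by rewrite mxE; case: (A i j).
under eq_fun do under eq_bigr do rewrite e /=.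
apply: continuous_sum => i; apply: continuous_fD; apply: continuous_fM;
  by [exact: ac|exact: bc].
Qed.

(** The squared norm of the image has a maximum on the compact unit sphere, and homogeneity extends
    the bound to all vectors. *)
Lemma norm_attained (A : 'M[C]_n.+1) : exists2 v, sqnorm v = 1 &
  bounded_by (sqnorm (A *m v)) A.
Proof.
have [F Fc FE] := continuous_sqnorm_mulmx A.
pose Q (x : 'rV[R]_(n.+1 + n.+1)) := \sum_k x 0 k ^+ 2.
have Qc : continuous Q.
  by apply: continuous_sum => k; apply: continuous_fM; exact: coord_continuous.
pose sphere := Q @^-1` [set 1].
have cpt : compact sphere.
  apply: bounded_closed_compact; last first.
    by apply: preimage_closed => [x _|]; [exact: Qc|exact: closed_eq].
  exists 1; split=> // M M1 x /= Qx.
  apply: le_trans (ltW M1).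
  rewrite [leLHS]/Num.norm /= mx_normrE; apply/bigmax_leP; split=> //= -[i k] _ /=.
  rewrite ord1 -[leRHS](@normr1 R) -ler_sqr ?nnegrE// -!normrX !expr1n normr1.
  rewrite ger0_norm ?sqr_ge0// -[leRHS]Qx /Q (bigD1 k)//= lerDl.
  by apply: sumr_ge0 => l _; rewrite sqr_ge0.
have [c0 Hc0] := cvec_surj (delta_mx 0 0).
have s0 : sphere !=set0.
  exists c0; have := sqnorm_cvec c0; rewrite Hc0 sqnorm_delta => e.
  by apply: (@complexI R); rewrite -e.
have [|c cs Hc] := EVT_max_rV s0 cpt (_ : {within sphere, continuous F}).
  by apply: continuous_subspaceT.
have Qc1 : sqnorm (cvec c) = 1 by rewrite sqnorm_cvec; move: cs; rewrite inE /sphere /= /Q => ->.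
exists (cvec c) => // w; have [->|w0] := eqVneq w 0.
  by rewrite mulmx0 sqnorm0 mulr0.
have wn0 : sqnorm w != 0 by apply: contra w0 => /eqP/sqnorm_eq0/eqP.
have wp : 0 < sqnorm w by rewrite lt0r wn0 sqnorm_ge0.
have cc : `|(sqrtC (sqnorm w))^-1| ^+ 2 = (sqnorm w)^-1.
  by rewrite normfV exprVn -normrX sqrtCK ger0_norm// ltW.
have [x xE] := cvec_surj ((sqrtC (sqnorm w))^-1 *: w).
have xs : x \in sphere.
  rewrite inE /sphere /=; apply: (@complexI R).
  by rewrite -sqnorm_cvec xE sqnormZ cc mulVf.
have := Hc x xs; rewrite -lecR -!FE xE -scalemxAr sqnormZ cc.
by rewrite mulrC ler_pdivrMr.
Qed.

End Attainment.

(** * Translation from pairs of reals to R[i] *)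

Section Translation.
Local Open Scope complex_scope.
Local Notation RC := (complex R).

Definition toC (z : Defs.C) : RC := z.1 +i* z.2.
Definition ofC (z : RC) : Defs.C := (complex.Re z, complex.Im z).
Definition toM n (A : Mat n) : 'M[RC]_n := \matrix_(i, j) toC (A i j).
Definition ofM n (A : 'M[RC]_n) : Mat n := fun i j => ofC (A i j).
Definition toV n (v : Vec n) : 'cV[RC]_n := \col_i toC (v i).

Lemma toCK : cancel toC ofC. Proof. by case. Qed.
Lemma ofCK : cancel ofC toC. Proof. by case. Qed.

Lemma toMK n : cancel (@toM n) (@ofM n).
Proof.
move=> A; apply/funext => i; apply/funext => j.
by rewrite /ofM mxE toCK.
Qed.

Lemma ofMK n : cancel (@ofM n) (@toM n).
Proof. by move=> A; apply/matrixP => i j; rewrite mxE ofCK. Qed.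

Lemma toC_sum n (F : 'I_n -> Defs.C) :
  toC (\big[Cadd/C0]_(k < n) F k) = \sum_(k < n) toC (F k).
Proof. by apply: (big_morph toC). Qed.

Lemma toM_mul n (A B : Mat n) : toM (mmul A B) = toM A *m toM B.
Proof.
apply/matrixP => i j; rewrite !mxE toC_sum; apply: eq_bigr => k _.
by rewrite !mxE.
Qed.

Lemma toV_mul n (A : Mat n) v : toV (mvmul A v) = toM A *m toV v.
Proof.
apply/colP => i; rewrite !mxE toC_sum; apply: eq_bigr => k _.
by rewrite !mxE.
Qed.

Lemma toM_add n (A B : Mat n) : toM (madd A B) = toM A + toM B.
Proof. by apply/matrixP => i j; rewrite !mxE. Qed.

Lemma toM_sub n (A B : Mat n) : toM (msub A B) = toM A - toM B.
Proof. by apply/matrixP => i j; rewrite !mxE. Qed.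

Lemma toM_id n : toM (mid n) = 1%:M.
Proof. by apply/matrixP => i j; rewrite !mxE /mid; case: eqP. Qed.

Lemma toM_scale_id n c : toM (mscale c (mid n)) = (toC c)%:M.
Proof.
rewrite -scalemx1 -toM_id.
by apply/matrixP => i j; rewrite !mxE.
Qed.

Lemma toM_conj n (A : Mat n) : toM (mconj A) = map_mx Num.conj (toM A).
Proof. by apply/matrixP => i j; rewrite !mxE. Qed.

Lemma toM_adj n (A : Mat n) : toM (madj A) = adj (toM A).
Proof. by apply/matrixP => i j; rewrite !mxE. Qed.

Lemma toM_shift m : toM (Sjordan m.+1) = @shift RC m.
Proof. by apply/matrixP => i j; rewrite !mxE /Sjordan; case: eqP. Qed.

(** The Horner scheme of [poly_at_S] has S on the left and [cons_poly_def] has ['X] on the right;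
    polynomials in S commute. *)
Lemma toM_poly_at_S m cs : toM (poly_at_S m.+1 cs) = shift_poly m (Poly (map toC cs)).
Proof.
elim: cs => [|c cs IH] /=.
  by rewrite shift_poly0; apply/matrixP => i j; rewrite !mxE.
rewrite cons_poly_def toM_add toM_mul toM_scale_id IH toM_shift.
by rewrite shift_polyD shift_polyM shift_polyX shift_polyC addrC -shift_polyX shift_poly_comm.
Qed.

Lemma inA_shift_poly m (p : {poly RC}) : inA (ofM (shift_poly m p)).
Proof.
exists (map ofC p); apply: (can_inj (@toMK _)).
by rewrite ofMK toM_poly_at_S -map_comp (eq_map (g := id)) ?map_id ?polyseqK// => z; rewrite
  /= ofCK.
Qed.

Lemma inA_toM m (A : Mat m.+1) : inA A -> exists p, toM A = shift_poly m p.
Proof. by case=> cs ->; exists (Poly (map toC cs)); rewrite toM_poly_at_S. Qed.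

Lemma sqnorm_toV n (v : Vec n) : sqnorm (toV v) = ((vnorm v) ^+ 2)%:C.
Proof.
rewrite sqnorm_ReIm /vnorm RsqrtE sqr_sqrtr.
  congr (_%:C); apply: eq_bigr => i _.
  by rewrite mxE /= !expr2.
elim/big_rec: _ => // i x _ x0.
by apply: addr_ge0 => //; rewrite /Cnorm2; apply: addr_ge0; exact: sqr_ge0.
Qed.

Lemma vnorm_ge0 n (v : Vec n) : 0 <= vnorm v.
Proof. by rewrite /vnorm RsqrtE sqrtr_ge0. Qed.

(** [opnorm] is a least upper bound picked by [epsilon]. The norming vector shows that one exists,
    and uniqueness identifies the one picked with the attained value. *)
Lemma bounded_by_opnorm m (A : Mat m.+1) :
  0 <= opnorm A /\ forall s, bounded_by s (toM A) <-> ((opnorm A) ^+ 2)%:C <= s.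
Proof.
have [v v1 bv] := norm_attained (toM A).
have [v' v'E] : exists v', toV v' = v.
  by exists (fun i => ofC (v i 0)); apply/colP => i; rewrite mxE ofCK.
have nE : sqnorm (toM A *m v) = (vnorm (mvmul A v') ^+ 2)%:C.
  by rewrite -v'E -toV_mul sqnorm_toV.
suff e : opnorm A = vnorm (mvmul A v').
  rewrite e vnorm_ge0; split=> // s; rewrite -nE; split=> [/(_ v)|le w].
    by rewrite v1 mulr1.
  by rewrite (le_trans (bv w))// ler_wpM2r ?sqnorm_ge0.
set E := (fun r => exists v : Vec m.+1, Rle (vnorm v) 1%R /\ r = vnorm (mvmul A v)).
have v'1 : vnorm v' = 1.
  have : (vnorm v' ^+ 2)%:C = 1 by rewrite -sqnorm_toV v'E.
  by move=> /(@complexI R)/eqP; rewrite sqrf_eq1 => /orP[/eqP//|/eqP e]; have := vnorm_ge0 v';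
    rewrite e ler0N1.
have lubE : is_lub E (vnorm (mvmul A v')).
  split=> [r [w [/RleP w1 ->]]|b /(_ (vnorm (mvmul A v')))]; last first.
    by apply; exists v'; split=> //; apply/RleP; rewrite v'1.
  apply/RleP; rewrite -ler_sqr ?nnegrE ?vnorm_ge0// -lecR -nE.
  rewrite -sqnorm_toV toV_mul (le_trans (bv _))// sqnorm_toV.
  by rewrite ler_piMr ?sqnorm_ge0// -[1]/(1%:C) lecR expr_le1// vnorm_ge0.
have [ub lub] : is_lub E (opnorm A).
  by apply: (epsilon_spec (inhabits _) (fun r => is_lub E r)); exists (vnorm (mvmul A v')).
apply: Rle_antisym; first by apply: lub; case: lubE.
by case: lubE => _; apply.
Qed.

Lemma complex_arch (x : RC) : exists k : nat, `|x| <= k%:R.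
Proof.
exists (Num.bound (complex.Re `|x|)).
have xr : `|x| = (complex.Re `|x|)%:C by rewrite RRe_real// normr_real.
rewrite {1}xr -(rmorph_nat (real_complex R)) lecR ltW// archi_boundP//.
by rewrite -lecR -xr; exact: normr_ge0.
Qed.

End Translation.

(** * Transfer of the rigidity statement to [opnorm] and [inA] *)

Local Open Scope R_scope.

Theorem theorem2p5 (n : nat) (phi : Mat n -> Mat n) :
  (1 < n)%N ->
  (* continuity on A with respect to the operator norm *)
  (forall A, inA A -> forall eps, 0 < eps -> exists delta, 0 < delta /\
     forall B, inA B -> opnorm (msub B A) < delta ->
       opnorm (msub (phi B) (phi A)) < eps) ->
  (* multiplicativity on A *)
  (forall A B, inA A -> inA B -> phi (mmul A B) = mmul (phi A) (phi B)) ->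
  (* norm preservation on A *)
  (forall A, inA A -> opnorm (phi A) = opnorm A) ->
  exists U : Mat n, unitary U /\
    ((forall A, inA A -> phi A = mmul (mmul U A) (madj U)) \/
     (forall A, inA A -> phi A = mmul (mmul U (mconj A)) (madj U))).
Proof.
case: n phi => [//|[//|m]] phi _ cont phiM phiN.
pose hS := (@shift_poly (complex R) m.+1).
pose phi' A := toM (phi (ofM A)).
have phi'M p q : phi' (hS p *m hS q)%R = (phi' (hS p) *m phi' (hS q))%R.
  have e : ofM (hS p *m hS q)%R = mmul (ofM (hS p)) (ofM (hS q)).
    by apply: (can_inj (@toMK _)); rewrite toM_mul !ofMK.
  by rewrite /phi' e phiM ?toM_mul//; exact: inA_shift_poly.
have phi'B p s : bounded_by s (phi' (hS p)) <-> bounded_by s (hS p).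
  rewrite -{2}[hS p]ofMK; rewrite (bounded_by_opnorm _).2 (bounded_by_opnorm _).2.
  by rewrite phiN//; exact: inA_shift_poly.
have phi'_cont (e : complex R) : (0 < e)%R -> exists2 d : complex R, (0 < d)%R &
  forall l, (`|l| < d)%R -> bounded_by e (phi' (hS ('X + l%:P)) - phi' (@shift _ m.+1))%R.
  move=> e0.
  have eE : e = ((complex.Re e)%:C)%C by rewrite RRe_real// gtr0_real.
  have r0 : (0 < complex.Re e)%R by rewrite -ltcR -eE.
  (* [bounded_by] takes squared norms, so continuity is invoked with the square root of [e], which
     is real because it is positive. *)
  have s0 : (0 < Num.sqrt (complex.Re e))%R by rewrite sqrtr_gt0.
  have SA : inA (ofM (@shift (complex R) m.+1)) by rewrite -shift_polyX; exact: inA_shift_poly.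
  have s0' : 0 < Num.sqrt (complex.Re e) by apply/RltP.
  have [d [/RltP d0 Hd]] := cont _ SA _ s0'.
  exists (d%:C)%C; first by rewrite ltcR.
  move=> l ld; rewrite /phi' -toM_sub; apply/(bounded_by_opnorm _).2.
  have : opnorm (msub (ofM (hS ('X + l%:P)%R)) (ofM (@shift _ m.+1))) < d.
    (* The difference of S + l and S is the scalar matrix [l], of norm at most [|l| < d]. *)
    set M := msub _ _; have [x0 xB] := bounded_by_opnorm M.
    have /xB le1 : bounded_by (`|l| ^+ 2)%R (toM M).
      rewrite /M toM_sub !ofMK /hS shift_polyD shift_polyX shift_polyC addrC addKr; exact:
        bounded_by_scalar.
    have lt2 : (`|l| ^+ 2 < (d ^+ 2)%:C%C)%R by rewrite rmorphXn ltrXn2r// ltW// ltcR.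
    have := le_lt_trans le1 lt2; rewrite ltcR ltr_sqr ?nnegrE//; last exact: ltW.
    by move=> /RltP.
  move=> /(Hd (ofM (hS ('X + l%:P)%R)) (@inA_shift_poly m.+1 _))/RltP xlt.
  rewrite eE lecR -[leRHS]sqr_sqrtr; last exact: ltW.
  rewrite ler_sqr ?nnegrE; [exact: ltW|exact: (bounded_by_opnorm _).1|exact: ltW].
have [U UU H] := shift_algebra_rigidity complex_arch phi'M phi'B phi'_cont (@norm_attained _ _).
have UU' := mulmx1C UU.
exists (ofM U); split.
  by split; apply: (can_inj (@toMK _)); rewrite toM_mul toM_adj toM_id ofMK.
case: H => H; [left|right] => A AA; apply: (can_inj (@toMK _));
  rewrite !toM_mul toM_adj ?toM_conj ofMK; have [p pE] := inA_toM AA;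
  by rewrite pE -H -pE /phi' toMK.
Qed.
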